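(* Let $k$ be an algebraically closed field, let $\mathcal{A}$ be a spectroid over $k$, and let $f: L \to M$ be an irreducible monomorphism in $\operatorname{mod}\mathcal{A}$. Then the cokernel $\operatorname{coker}(f)$ of $f$ is finitely generated. Moreover: (1) If $L$ is finitely generated, then $\operatorname{coker}(f)$ is finitely presented. (2) If the canonical morphism $M \to \operatorname{coker}(f)$ is also irreducible, then $\operatorname{coker}(f)$ is finitely presented. (3) If $\mathcal{A}$ is hereditary and given by a strongly locally finite quiver $Q$ (that is, $\mathcal{A}=kQ$), and $L$ is a finite direct sum of indecomposable modules, then $\operatorname{coker}(f)$ is finitely presented.
   Context: $k$ is an algebraically closed field; all categories are preadditive $k$-categories. A spectroid is a Hom-finite $k$-category $\mathcal{A}$ (all Hom spaces are finite dimensional over $k$) in which all objects have local endomorphism algebras and distinct objects are not isomorphic. $\operatorname{Mod}\mathcal{A}$ is the category of all $k$-linear covariant functors from $\mathcal{A}$ to $k$-vector spaces, and $\operatorname{mod}\mathcal{A}$ is its full subcategory of functors with values in finite dimensional $k$-vector spaces (locally finite dimensional modules). $\mathcal{A}$ is hereditary if $\operatorname{Mod}\mathcal{A}$ is a hereditary category. For an object $a$ of $\mathcal{A}$, put $P_a=\operatorname{Hom}_{\mathcal{A}}(a,-)$. A module $M$ is finitely generated if there is an epimorphism $\bigoplus_{i=1}^r P_{a_i}\to M$ for finitely many objects $a_1,\dots,a_r$, and finitely presented if moreover the kernel of this epimorphism is finitely generated. A morphism is irreducible in $\operatorname{mod}\mathcal{A}$ if it is neither a section nor a retraction and, whenever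 it factors as $\gamma\beta$ in $\operatorname{mod}\mathcal{A}$, then $\beta$ is a section or $\gamma$ is a retraction. A quiver $Q$ is strongly locally finite if it is locally finite (each vertex is incident to finitely many arrows) and interval finite (for any two vertices $x,y$ there are finitely many paths from $x$ to $y$); $kQ$ denotes its path category. *)

(* Defs.v *)
From HB Require Import structures.
From mathcomp Require Import all_boot all_algebra.
From mathcomp Require Import finmap.
From mathcomp.classical Require Import boolp classical_sets cardinality.
From mathcomp.multinomials Require Import monalg.
Set Implicit Arguments.
Unset Strict Implicit.
Unset Printing Implicit Defensive.
Import GRing.Theory.
Local Open Scope ring_scope.
#[local] Obligation Tactic := idtac.

Record kcat (k : fieldType) := KCat {
  obj :> Type;
  Hom : obj -> obj -> lmodType k;
  idm : forall a, Hom a a;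
  comp : forall a b c, Hom b c -> Hom a b -> Hom a c;
  comp_assoc : forall a b c d (h : Hom c d) (g : Hom b c) (f : Hom a b),
    comp h (comp g f) = comp (comp h g) f;
  comp_idl : forall a b (f : Hom a b), comp (idm b) f = f;
  comp_idr : forall a b (f : Hom a b), comp f (idm a) = f;
  comp_linear : forall a b c (g : Hom b c), linear (@comp a b c g);
  comp_linearl : forall a b c (f : Hom a b),
    linear (fun g : Hom b c => comp g f)
}.

Arguments Hom {k A} : rename.
Arguments idm {k A} a : rename.
Arguments comp {k A a b c} : rename.

HB.instance Definition _ (k : fieldType) (A : kcat k) (a b c : A)
    (g : Hom b c) :=
  GRing.isLinear.Build k (Hom a b) (Hom a c) *:%R (comp g)
    (@comp_linear k A a b c g).

Definition fin_dim (k : fieldType) (V : lmodType k) : Prop :=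
  exists n, inhabited (Vector.axiom n V).

Section Spectroid.
Context (k : fieldType) (A : kcat k).

Definition isom (a b : A) (f : Hom a b) : Prop :=
  exists g : Hom b a, comp g f = idm a /\ comp f g = idm b.

Definition local_end (a : A) : Prop :=
  idm a <> 0 /\
  forall f g : Hom a a, ~ isom f -> ~ isom g -> ~ isom (f + g).

Definition spectroid : Prop :=
  [/\ forall a b : A, fin_dim (Hom a b),
      forall a : A, local_end a
    & forall (a b : A) (f : Hom a b), isom f -> a = b].

End Spectroid.

(* Objects of Mod A: covariant k-linear functors from A to k-vector spaces. *)
Record kmod (k : fieldType) (A : kcat k) := KMod {
  val_at :> A -> lmodType k;
  act : forall a b, Hom a b -> {linear val_at a -> val_at b};
  act_id : forall a (x : val_at a), act (idm a) x = x;
  act_comp : forall a b c (g : Hom b c) (f : Hom a b) (x : val_at a),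
    act (comp g f) x = act g (act f x);
  act_linear : forall a b (x : val_at a),
    linear (fun f : Hom a b => act f x)
}.

Arguments act {k A} M {a b} f : rename.

Record mhom (k : fieldType) (A : kcat k) (M N : kmod A) := MHom {
  mhom_at :> forall a, {linear M a -> N a};
  mhom_nat : forall (a b : A) (u : Hom a b) (x : M a),
    mhom_at b (act M u x) = act N u (mhom_at a x)
}.

Definition mhom_eq (k : fieldType) (A : kcat k) (M N : kmod A)
    (f g : mhom M N) : Prop :=
  forall a (x : M a), f a x = g a x.

Notation "f =m g" := (mhom_eq f g) (at level 70, no associativity).

Section ModuleConstructions.
Context (k : fieldType) (A : kcat k).

Program Definition mid (M : kmod A) : mhom M M :=
  @MHom _ _ M M (fun a => idfun : {linear M a -> M a}) _.
Next Obligation. by []. Qed.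

Program Definition mcomp (M N P : kmod A) (g : mhom N P) (f : mhom M N) :
    mhom M P :=
  @MHom _ _ M P (fun a => (g a \o f a : M a -> P a) : {linear M a -> P a}) _.
Next Obligation. by move=> M N P g f a b u x /=; rewrite !mhom_nat. Qed.

Program Definition mzero (M N : kmod A) : mhom M N :=
  @MHom _ _ M N (fun a => (\0 : M a -> N a) : {linear M a -> N a}) _.
Next Obligation. by move=> M N a b u x /=; rewrite linear0. Qed.

Program Definition zero_mod : kmod A :=
  @KMod _ A (fun _ => 'rV[k]_0)
    (fun _ _ _ => idfun : {linear 'rV[k]_0 -> 'rV[k]_0}) _ _ _.
Next Obligation. by []. Qed.
Next Obligation. by []. Qed.
Next Obligation.
by move=> a b x c f g; apply/rowP; case. Qed.

(* P_a = Hom(a, -) *)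
Program Definition repr_mod (a : A) : kmod A :=
  @KMod _ A (fun b => Hom a b)
    (fun b c g => comp g : {linear Hom a b -> Hom a c}) _ _ _.
Next Obligation. by move=> a b f /=; rewrite comp_idl. Qed.
Next Obligation. by move=> a b c d g f x /=; rewrite comp_assoc. Qed.
Next Obligation. by move=> a b c x; exact: comp_linearl. Qed.

Section BinarySum.
Context (M N : kmod A).

Definition sum_act (a b : A) (f : Hom a b) (x : M a * N a) : M b * N b :=
  (act M f x.1, act N f x.2).

Fact sum_act_linear (a b : A) (f : Hom a b) : linear (sum_act f).
Proof. by move=> c x y; rewrite /sum_act !linearP. Qed.

HB.instance Definition _ (a b : A) (f : Hom a b) :=
  GRing.isLinear.Build k (M a * N a)%type (M b * N b)%type *:%R (sum_act f)
    (sum_act_linear f).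

Program Definition sum_mod : kmod A :=
  @KMod _ A (fun a => (M a * N a)%type)
    (fun a b f => sum_act f : {linear (M a * N a)%type -> (M b * N b)%type}) _ _ _.
Next Obligation. by move=> a [x y]; rewrite /= /sum_act /= !act_id. Qed.
Next Obligation.
by move=> a b c g f [x y]; rewrite /= /sum_act /= !act_comp. Qed.
Next Obligation.
by move=> a b [x y] c f g; rewrite /= /sum_act /= !act_linear. Qed.

End BinarySum.

Definition direct_sum (s : seq (kmod A)) : kmod A := foldr sum_mod zero_mod s.

End ModuleConstructions.

(* A full subcategory of Mod A is encoded as a predicate on its objects. *)
Section FullSubcategories.
Context (k : fieldType) (A : kcat k).

Definition any_module : kmod A -> Prop := fun=> True.

Definition locally_fd : kmod A -> Prop := fun M => forall a, fin_dim (M a).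

Definition section (M N : kmod A) (f : mhom M N) : Prop :=
  exists r : mhom N M, mcomp r f =m mid M.

Definition retraction (M N : kmod A) (f : mhom M N) : Prop :=
  exists s : mhom N M, mcomp f s =m mid N.

Definition mod_isomorphic (M N : kmod A) : Prop :=
  exists (f : mhom M N) (g : mhom N M), mcomp g f =m mid M /\ mcomp f g =m mid N.

Section In.
Variable C : kmod A -> Prop.

Definition mono_in (M N : kmod A) (f : mhom M N) : Prop :=
  forall X, C X -> forall u v : mhom X M, mcomp f u =m mcomp f v -> u =m v.

Definition epi_in (M N : kmod A) (f : mhom M N) : Prop :=
  forall X, C X -> forall u v : mhom N X, mcomp u f =m mcomp v f -> u =m v.

Definition kernel_in (K M N : kmod A) (i : mhom K M) (p : mhom M N) : Prop :=
  [/\ C K, mcomp p i =m mzero K N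
    & forall X, C X -> forall h : mhom X M, mcomp p h =m mzero X N ->
        exists u : mhom X K, mcomp i u =m h /\
          forall v : mhom X K, mcomp i v =m h -> v =m u].

Definition cokernel_in (M N P : kmod A) (f : mhom M N) (p : mhom N P) : Prop :=
  [/\ C P, mcomp p f =m mzero M P
    & forall X, C X -> forall h : mhom N X, mcomp h f =m mzero M X ->
        exists u : mhom P X, mcomp u p =m h /\
          forall v : mhom P X, mcomp v p =m h -> v =m u].

Definition irreducible_in (M N : kmod A) (f : mhom M N) : Prop :=
  [/\ C M, C N, ~ section f, ~ retraction f
    & forall X, C X -> forall (b : mhom M X) (g : mhom X N),
        f =m mcomp g b -> section b \/ retraction g].

End In.

Definition finitely_generated (M : kmod A) : Prop :=
  exists (s : seq A) (p : mhom (direct_sum (map (@repr_mod k A) s)) M),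
    epi_in any_module p.

Definition finitely_presented (M : kmod A) : Prop :=
  exists (s : seq A) (p : mhom (direct_sum (map (@repr_mod k A) s)) M),
    epi_in any_module p /\
    exists (K : kmod A) (i : mhom K (direct_sum (map (@repr_mod k A) s))),
      kernel_in any_module i p /\ finitely_generated K.

Definition projective (P : kmod A) : Prop :=
  forall (M N : kmod A) (e : mhom M N) (h : mhom P N),
    epi_in any_module e -> exists l : mhom P M, mcomp e l =m h.

(* The convention for hereditary categories with enough projectives: subobjects
   of projectives are projective. *)
Definition hereditary : Prop :=
  forall (K P : kmod A) (i : mhom K P),
    projective P -> mono_in any_module i -> projective K.

Definition zero_module (M : kmod A) : Prop := forall a (x : M a), x = 0.

Definition indecomposable (M : kmod A) : Prop :=
  ~ zero_module M /\
  forall X Y : kmod A,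
    mod_isomorphic M (sum_mod X Y) -> zero_module X \/ zero_module Y.

Definition finite_sum_of_indecomposables (M : kmod A) : Prop :=
  exists n (F : 'I_n -> kmod A),
    (forall i, indecomposable (F i)) /\
    mod_isomorphic M (direct_sum [seq F i | i <- enum 'I_n]).

End FullSubcategories.

Arguments any_module {k A}.
Arguments locally_fd {k A}.

Record quiver := Quiver {
  vertex :> Type;
  arrow : vertex -> vertex -> Type
}.

Arguments arrow {Q} : rename.

Inductive qpath (Q : quiver) : Q -> Q -> Type :=
| qnil x : qpath x x
| qcons x y z : arrow x y -> qpath y z -> qpath x z.

Arguments qnil {Q} x.

(* qcat p q is p followed by q, so that in the path category it represents the
   composite of q after p. *)
Fixpoint qcat (Q : quiver) (x y z : Q) (p : qpath x y) :
    qpath y z -> qpath x z :=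
  match p with
  | qnil _ => id
  | qcons _ _ _ a p' => fun q => qcons a (qcat p' q)
  end.

Definition locally_finite (Q : quiver) : Prop :=
  forall x : Q, finite_set [set: {y : Q & arrow x y}] /\
                finite_set [set: {y : Q & arrow y x}].

Definition interval_finite (Q : quiver) : Prop :=
  forall x y : Q, finite_set [set: qpath x y].

Definition strongly_locally_finite (Q : quiver) : Prop :=
  locally_finite Q /\ interval_finite Q.

Section LinearExtension.
Context (k : fieldType) (T : choiceType) (V : lmodType k) (h : T -> V).

Definition lin_ext (g : {malg k[T]}) : V := \sum_(t <- msupp g) g@_t *: h t.

Lemma lin_extEw (d : {fset T}) (g : {malg k[T]}) :
  (msupp g `<=` d)%fset -> lin_ext g = \sum_(t <- d) g@_t *: h t.
Proof.
move=> sgd; rewrite /lin_ext; apply: big_fset_incl => // t _ tg.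
by rewrite mcoeff_outdom ?scale0r.
Qed.

Fact lin_ext_linear : linear lin_ext.
Proof.
move=> c f g; pose d := (msupp f `|` msupp g `|` msupp (c *: f + g))%fset.
have sf : (msupp f `<=` d)%fset by rewrite /d -fsetUA fsubsetUl.
have sg : (msupp g `<=` d)%fset.
  by rewrite /d (fsetUC (msupp f)) -fsetUA fsubsetUl.
have sfg : (msupp (c *: f + g) `<=` d)%fset by rewrite fsubsetUr.
rewrite (lin_extEw sf) (lin_extEw sg) (lin_extEw sfg) scaler_sumr -big_split.
by apply: eq_bigr => t _; rewrite mcoeffD mcoeffZ scalerDl scalerA.
Qed.

HB.instance Definition _ :=
  GRing.isLinear.Build k {malg k[T]} V *:%R lin_ext lin_ext_linear.

Lemma lin_extU t : lin_ext << t >> = h t.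
Proof. by rewrite /lin_ext msuppU oner_eq0 big_seq_fset1 mcoeffUU scale1r. Qed.

End LinearExtension.

Section PathCategory.
Context (k : fieldType) (Q : quiver).

Definition path_hom (x y : Q) : lmodType k := {malg k[{classic qpath x y}]}.

Definition path_class (x y : Q) (p : qpath x y) : path_hom x y :=
  << (p : {classic qpath x y}) >>.

(* The bilinear extension of concatenation. *)
Definition path_comp (x y z : Q) (g : path_hom y z) (f : path_hom x y) :
    path_hom x z :=
  lin_ext (fun p : {classic qpath x y} =>
    lin_ext (fun q : {classic qpath y z} => path_class (qcat p q)) g) f.

Lemma path_hom_ind (x y : Q) (P : path_hom x y -> Prop) :
  (forall c f g, P f -> P g -> P (c *: f + g)) ->
  P 0 -> (forall p, P (path_class p)) -> forall f, P f.
Proof.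
move=> PL P0 Pp f; rewrite (monalgE f).
elim/big_ind: _ => [//|f1 f2 P1 P2|p _]; first by rewrite -(scale1r f1); apply: PL.
have -> : << f@_p *g p >> = f@_p *: path_class p + 0 :> path_hom x y.
  apply/malgP => q; rewrite addr0 mcoeffZ !mcoeffU.
  by case: eqP => _; rewrite ?mulr1n ?mulr1 ?mulr0n ?mulr0.
exact: PL.
Qed.

Lemma path_compE (x y z : Q) (p : qpath x y) (q : qpath y z) :
  path_comp (path_class q) (path_class p) = path_class (qcat p q).
Proof. by rewrite /path_comp !lin_extU. Qed.

Fact path_comp_linear (x y z : Q) (g : path_hom y z) :
  linear (@path_comp x y z g).
Proof. by move=> c f f'; rewrite /path_comp linearP. Qed.

Fact path_comp_linearl (x y z : Q) (f : path_hom x y) :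
  linear (fun g : path_hom y z => path_comp g f).
Proof.
pose F g (p : {classic qpath x y}) :=
  lin_ext (fun q : {classic qpath y z} => path_class (qcat p q)) g.
have E g : path_comp g f = \sum_(p <- msupp f) f@_p *: F g p by [].
move=> c g g'; rewrite !E scaler_sumr -big_split; apply: eq_bigr => p _ /=.
by rewrite /F linearP scalerDr !scalerA mulrC.
Qed.

HB.instance Definition _ (x y z : Q) (g : path_hom y z) :=
  GRing.isLinear.Build k (path_hom x y) (path_hom x z) *:%R (path_comp g)
    (@path_comp_linear x y z g).

Lemma path_comp0l (x y z : Q) (f : path_hom x y) :
  path_comp (0 : path_hom y z) f = 0.
Proof.
have := path_comp_linearl f (-1) (0 : path_hom y z) 0.
by rewrite !scaleN1r oppr0 addr0 addNr.
Qed.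

Lemma qcat_nil (x y : Q) (p : qpath x y) : qcat p (qnil y) = p.
Proof. by elim: p => //= {}x w z a p ->. Qed.

Lemma qcatA (x y z w : Q) (p : qpath x y) (q : qpath y z) (r : qpath z w) :
  qcat p (qcat q r) = qcat (qcat p q) r.
Proof. by elim: p q => //= {}x v u a p IHp q; rewrite IHp. Qed.

Fact path_comp_assoc (x y z w : Q) (h : path_hom z w) (g : path_hom y z)
    (f : path_hom x y) :
  path_comp h (path_comp g f) = path_comp (path_comp h g) f.
Proof.
elim/path_hom_ind: f => [c f f' IH IH'||p]; first by rewrite !path_comp_linear IH IH'.
  by rewrite !linear0.
elim/path_hom_ind: g => [c g g' IH IH'||q].
- by rewrite path_comp_linearl !path_comp_linear path_comp_linearl IH IH'.
- by rewrite !(path_comp0l, linear0).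
elim/path_hom_ind: h => [c h h' IH IH'||r].
- by rewrite !path_comp_linearl IH IH'.
- by rewrite !path_comp0l.
by rewrite !path_compE qcatA.
Qed.

Fact path_comp_idl (x y : Q) (f : path_hom x y) :
  path_comp (path_class (qnil y)) f = f.
Proof.
elim/path_hom_ind: f => [c f f' IH IH'||p]; first by rewrite !path_comp_linear IH IH'.
  by rewrite linear0.
by rewrite path_compE qcat_nil.
Qed.

Fact path_comp_idr (x y : Q) (f : path_hom x y) :
  path_comp f (path_class (qnil x)) = f.
Proof.
elim/path_hom_ind: f => [c f f' IH IH'||p].
- by rewrite path_comp_linearl IH IH'.
- by rewrite path_comp0l.
by rewrite path_compE.
Qed.

Definition path_category : kcat k :=
  KCat path_comp_assoc path_comp_idl path_comp_idr
    path_comp_linear path_comp_linearl.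

End PathCategory.

Definition kcat_isomorphic (k : fieldType) (A B : kcat k) : Prop :=
  exists (F : A -> B)
         (FH : forall a b : A, {linear Hom a b -> Hom (F a) (F b)}),
    [/\ bijective F,
        forall a b : A, bijective (FH a b),
        forall a : A, FH a a (idm a) = idm (F a)
      & forall (a b c : A) (g : Hom b c) (f : Hom a b),
          FH a c (comp g f) = comp (FH b c g) (FH a b f)].

(* Main.v *)
From HB Require Import structures.
From mathcomp Require Import all_boot all_algebra.
From mathcomp.classical Require Import boolp classical_sets cardinality.
From mathcomp.multinomials Require Import monalg.
Require Import Defs.

(** Write [p : M -> C] for the cokernel of the irreducible monomorphism [f].
    Pulling [p] back along a map [h : X -> C] with [X] locally finite
    dimensional factors [f] through the pullback, so irreducibility gives the
    dichotomy [lift_or_factor]: either [h] lifts to [M], or [p] factors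
    through [h].  Moreover [p] has no section, since [f] would split.

    The second tool is linear compactness ([section_compact]): because the
    values of [M] and [C] are finite dimensional, a section of [p] exists as
    soon as one exists over every finite set of objects.  Indeed a section is a
    solution of a system of linear equations, each in finitely many unknowns,
    and such a system is solvable when all its finite parts are.

    If [C] were not finitely generated, the inclusion of a finitely generated
    submodule could not be a factor of [p], so it would lift to [M];
    compactness would then split [p].  Hence [C] is a quotient of a finite sum
    of representables [P], with kernel [K].  If [P/K0 -> C] lifted to [M] for
    every finitely generated [K0] in [K], compactness would split [p] again.
    So there are [K0] finitely generated and [t : M -> P/K0] over [C]
    ([factor_through_presented]), and the same holds for any larger [K0].

    When the image of [f] under [t] is finitely generated, enlarging [K0] kills
    it; then [t] descends to a section of [P/K0 -> C], and [K/K0], being a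
    direct summand of [P/K0], is finitely generated
    ([kernel_generated_of_image]).  This is immediate when [L] is finitely
    generated.  When [p] is irreducible, [t] is a section or [P/K0 -> C] is a
    retraction; the first is excluded by enlarging [K0] so that [t] kills a
    nonzero element of [L].

    In the hereditary case [K0] is enlarged so that [K/K0] is projective
    ([projective_truncation], where interval finiteness enters).  The image in
    [K/K0] of an indecomposable summand of [L] is then projective, and the same
    truncation splits off a finitely generated piece of it; indecomposability
    makes this piece the whole image ([indecomposable_image_generated]). *)

Set Implicit Arguments.
Unset Strict Implicit.
Unset Printing Implicit Defensive.
Import GRing.Theory.
Local Open Scope ring_scope.

(** * Linear relations, subspaces and quotient spaces *)
Section LinearAlgebra.
Context (k : fieldType).
Implicit Types U V W : lmodType k.

Lemma linear_bundle V W (f : V -> W) :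
  linear f -> exists phi : {linear V -> W}, phi =1 f.
Proof.
move=> lf; pose m := GRing.isLinear.Build k V W *:%R f lf.
by exists (HB.pack_for {linear V -> W} f m).
Qed.

(** Linear maps are obtained below from their graphs: a relation that is a
    linear subspace of [V * W], single-valued and total is a map. *)
Definition linear_relation V W (G : V -> W -> Prop) : Prop :=
  G 0 0 /\ forall c v w v' w', G v w -> G v' w' -> G (c *: v + v') (c *: w + w').

Lemma linear_relationB V W (G : V -> W -> Prop) v w v' w' :
  linear_relation G -> G v w -> G v' w' -> G (v - v') (w - w').
Proof.
move=> [_ Glin] Gvw Gvw'; rewrite addrC [w - _]addrC.
by rewrite -[- v']scaleN1r -[- w']scaleN1r; apply: Glin.
Qed.

Lemma linear_relation_map V W (G : V -> W -> Prop) :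
  linear_relation G -> (forall w, G 0 w -> w = 0) -> (forall v, exists w, G v w) ->
  exists phi : {linear V -> W}, forall v w, G v w <-> phi v = w.
Proof.
move=> Glin Gfun Gtot; pose g v := projT1 (cid (Gtot v)).
have gP v : G v (g v) by rewrite /g; case: cid.
have gU v w : G v w -> g v = w.
  move=> Gvw; apply/eqP; rewrite -subr_eq0; apply/eqP/Gfun.
  by rewrite -(subrr v); apply: linear_relationB.
have [phi phiE] : exists phi : {linear V -> W}, phi =1 g.
  by apply: linear_bundle => c v v'; apply: gU; apply: Glin.2.
by exists phi => v w; rewrite phiE; split=> [/gU|<-].
Qed.

(** Zorn's lemma: a maximal single-valued linear relation is total, since a
    vector outside its domain can be sent to 0. *)
Lemma linear_relation_extend V W (G : V -> W -> Prop) :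
  linear_relation G -> (forall w, G 0 w -> w = 0) ->
  exists phi : {linear V -> W}, forall v w, G v w -> phi v = w.
Proof.
move=> Glin Gfun.
(* The empty set is admitted only because it is the union of the empty chain. *)
pose P (B : set (V * W)) := B = set0 \/
  [/\ forall v w, G v w -> B (v, w), linear_relation (fun v w => B (v, w))
    & forall w, B (0, w) -> w = 0].
have [|B [PB Bmax]] := @Zorn_bigcup _ P.
  move=> F FP Ftot.
  have [F0|] := pselect (forall X, F X -> X = set0).
    by left; apply/seteqP; split=> // x [X FX]; rewrite (F0 X FX).
  move=> /existsNP [X0 /not_implyP [FX0 X0n]]; right.
  have [//|[GX0 X0lin X0fun]] := FP _ FX0.
  split=> [v w Gvw||w [X FX Xw]]; first by exists X0; last exact: GX0.
    split=> [|c v w v' w' [X FX Xv] [Y FY Yv]]; first by exists X0; last exact: X0lin.1.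
    have [Z [FZ Zv Zv']] : exists Z, [/\ F Z, Z (v, w) & Z (v', w')].
      by have [XY|YX] := Ftot _ _ FX FY; [exists Y|exists X]; split=> //;
        apply: XY || apply: YX.
    have [Z0|[_ [_ Zlin] _]] := FP _ FZ; first by rewrite Z0 in Zv.
    by exists Z => //; apply: Zlin.
  by have [X0'|[_ _]] := FP _ FX; [rewrite X0' in Xw | apply].
have [GB Blin Bfun] : [/\ forall v w, G v w -> B (v, w),
    linear_relation (fun v w => B (v, w)) & forall w, B (0, w) -> w = 0].
  have [B0|//] := PB; exfalso; apply: (Bmax (fun x => G x.1 x.2)).
    by rewrite B0; split=> [x []|/(_ (0, 0) Glin.1)].
  by right; split.
have [|phi phiP] := linear_relation_map Blin Bfun; last first.
  by exists phi => v w /GB /phiP.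
move=> v; apply: contrapT => Bv.
(* Otherwise [B] extends to the line spanned by [v] with value 0 at [v]. *)
apply: (Bmax (fun x => exists c v' w, [/\ B (v', w), x.1 = c *: v + v' & x.2 = w])).
  split=> [[v' w] Bvw|sub]; first by exists 0, v', w; rewrite scale0r add0r.
  apply: Bv; exists 0; apply: sub; exists 1, 0, 0; split => //=; first exact: Blin.1.
  by rewrite scale1r addr0.
right; split=> [v' w /GB Bvw||w] /=.
- by exists 0, v', w; rewrite scale0r add0r.
- split=> [|c _ _ _ _ [d [v1 [w1 [B1 -> ->]]]] [e [v2 [w2 [B2 -> ->]]]]].
    by exists 0, 0, 0; rewrite scale0r add0r; split=> //; exact: Blin.1.
  exists (c * d + e), (c *: v1 + v2), (c *: w1 + w2); split=> //.
    exact: Blin.2.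
  by rewrite scalerDl scalerDr scalerA addrACA.
case=> c [v' [w' [Bvw + ->]]].
have [->|c0] := eqVneq c 0.
  by rewrite scale0r add0r => v'0; apply: Bfun; rewrite v'0.
move=> /esym /addr0_eq cv; case: Bv; exists (- c^-1 *: w').
have := Blin.2 (- c^-1) _ _ _ _ Bvw Blin.1; rewrite !addr0.
by rewrite -cv scalerN scaleNr opprK scalerA mulVf // scale1r.
Qed.

Definition subspace V (S : V -> Prop) : Prop :=
  S 0 /\ forall c v w, S v -> S w -> S (c *: v + w).

Section Subspace.
Context (V : lmodType k) (S : V -> Prop) (S_sub : subspace S).

(** The proof that [S] is a subspace is an argument so that the module
    structure of the subtype can be inferred from its type. *)
Definition subspace_pred of subspace S : {pred V} := fun v => `[< S v >].

Fact subspace_pred_closed : submod_closed (subspace_pred S_sub).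
Proof.
split=> [|c v w]; rewrite /subspace_pred !unfold_in; first exact/asboolP/S_sub.1.
by move=> /asboolP Sv /asboolP Sw; apply/asboolP/S_sub.2.
Qed.

HB.instance Definition _ :=
  GRing.isSubmodClosed.Build k V (subspace_pred S_sub) subspace_pred_closed.

Definition subspace_type := {v : V | v \in subspace_pred S_sub}.
HB.instance Definition _ := [isSub of subspace_type for @sval _ _].
HB.instance Definition _ := [Choice of subspace_type by <:].
HB.instance Definition _ := [SubChoice_isSubLmodule of subspace_type by <:].

End Subspace.

Lemma subspace_exists V (S : V -> Prop) : subspace S ->
  exists (U : lmodType k) (i : {linear U -> V}),
    injective i /\ forall v, S v <-> exists u, i u = v.
Proof.
move=> Ssub; exists (subspace_type Ssub), val; split; first exact: val_inj.
move=> v; split=> [Sv|[u <-]]; last exact/asboolP/(valP u).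
have Sv' : v \in subspace_pred Ssub by apply/asboolP.
by exists (exist _ v Sv').
Qed.

(** The quotient is realized as a complement: the kernel of a projection onto
    [S]. *)
Lemma quotient_space_exists V (S : V -> Prop) : subspace S ->
  exists (U : lmodType k) (pi : {linear V -> U}),
    (forall u, exists v, pi v = u) /\ forall v, S v <-> pi v = 0.
Proof.
move=> Ssub; have [U [i [i_inj iS]]] := subspace_exists Ssub.
have [||r rP] := @linear_relation_extend V U (fun v u => i u = v).
- by split=> [|c v w v' w' <- <-]; rewrite ?linear0 ?linearP.
- by move=> w; rewrite -(linear0 i) => /i_inj.
have ri u : r (i u) = u by exact: rP.
have [|Q [j [j_inj jr]]] := @subspace_exists V (fun v => r v = 0).
  by split=> [|c v w rv rw]; rewrite ?linear0 // linearP rv rw scaler0 addr0.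
have [|||pi piP] := @linear_relation_map V Q (fun v q => j q = v - i (r v)).
- split=> [|c v w v' w' jw jw']; first by rewrite (linear0 j) (linear0 r) (linear0 i) subr0.
  by rewrite !linearP jw jw' scalerDr addrACA.
- by move=> w; rewrite (linear0 r) (linear0 i) subrr -(linear0 j) => /j_inj.
- by move=> v; apply/jr; rewrite linearB ri subrr.
exists Q, pi; split=> [q|v].
  exists (j q); apply/piP.
  have -> : r (j q) = 0 by apply/jr; exists q.
  by rewrite linear0 subr0.
rewrite -piP linear0; split=> [/iS [u <-]|/eqP]; first by rewrite ri subrr.
by rewrite eq_sym subr_eq0 => /eqP ->; apply/iS; exists (r v).
Qed.

(** The image in row vectors is the row space of a matrix of maximal rank among
    those whose rows lie in it. *)
Lemma fin_dim_inj V W (f : {linear V -> W}) :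
  injective f -> fin_dim W -> fin_dim V.
Proof.
move=> f_inj [n [[c clin cbij]]].
have [g gE] := linear_bundle clin.
pose S (u : 'rV[k]_n) := exists v, g (f v) = u.
have Ssub : subspace S.
  split=> [|a _ _ [v <-] [w <-]]; first by exists 0; rewrite !linear0.
  by exists (a *: v + w); rewrite !linearP.
pose Q r := `[< exists A : 'M[k]_n, \rank A = r /\ forall i, S (row i A) >].
have Qex : exists r, Q r.
  by exists 0; apply/asboolP; exists 0; rewrite mxrank0; split=> // i;
    rewrite row0; exact: Ssub.1.
have Qle r : Q r -> (r <= n)%N by move=> /asboolP [A [<- _]]; exact: rank_leq_row.
have [r /asboolP [A [rA SA]] rmax] := ex_maxnP Qex Qle.
have Slin m (B : 'M_(m, n)) u : (forall i, S (row i B)) -> (u <= B)%MS -> S u.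
  move=> SB /submxP [D ->]; rewrite mulmx_sum_row.
  elim/big_ind: _ => [|x y Sx Sy|j _]; first exact: Ssub.1.
    by rewrite -[x]scale1r; apply: Ssub.2.
  by rewrite -[_ *: _]addr0; apply: Ssub.2 => //; exact: Ssub.1.
have SU u : S u -> (u <= A)%MS.
  move=> Su; have : (\rank (A + u)%MS <= \rank A)%N.
    rewrite rA; apply: rmax; apply/asboolP; exists (A + u)%MS; split=> // i.
    have /sub_addsmxP [[a b] /= ->] := row_sub i (A + u)%MS.
    rewrite -[a *m A]scale1r; apply: Ssub.2; apply: Slin (submxMl _ _) => // j.
    by rewrite row_id.
  move=> rAu; apply: submx_trans (addsmxSr A u) _.
  by rewrite -(mxrank_leqif_sup (addsmxSl A u)) eqn_leq rAu mxrankS ?addsmxSl.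
pose B := row_base A.
exists (\rank A); constructor; exists (fun v => g (f v) *m pinvmx B).
  by move=> a v w; rewrite !linearP /= mulmxDl scalemxAl.
have KB v : g (f v) *m pinvmx B *m B = g (f v).
  by rewrite mulmxKpV // eq_row_base; apply: SU; exists v.
have gf_inj : injective (fun v => g (f v)).
  by move=> v w; rewrite !gE => /(bij_inj cbij) /f_inj.
have Sex w : exists v, g (f v) = w *m B.
  by apply: Slin SA _; rewrite -(eq_row_base A) submxMl.
exists (fun w => projT1 (cid (Sex w))) => [v|w]; case: cid => v' /= v'E.
  by apply: gf_inj; rewrite /= v'E KB.
by rewrite v'E mulmxKp // row_base_free.
Qed.

Lemma linear_section_exists V W (f : {linear V -> W}) :
  (forall w, exists v, f v = w) -> exists s : {linear W -> V}, cancel s f.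
Proof.
move=> f_surj; have [|U [i [i_inj iS]]] := @subspace_exists V (fun v => f v = 0).
  by split=> [|c v w fv fw]; rewrite ?linear0 // linearP fv fw scaler0 addr0.
have fi u : f (i u) = 0 by apply/iS; exists u.
have [||r rP] := @linear_relation_extend V U (fun v u => i u = v).
- by split=> [|c v w v' w' <- <-]; rewrite ?linear0 ?linearP.
- by move=> w; rewrite -(linear0 i) => /i_inj.
have ri u : r (i u) = u by exact: rP.
have [|||s sP] := @linear_relation_map W V (fun w v => f v = w /\ r v = 0).
- split=> [|c v w v' w' [<- rw] [<- rw']]; first by rewrite !linear0.
  by rewrite !linearP rw rw' scaler0 addr0.
- by move=> w [/iS [u <-]]; rewrite ri => ->; rewrite linear0.
- move=> w; have [v <-] := f_surj w.
  by exists (v - i (r v)); rewrite !linearB /= ri fi subr0 subrr.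
by exists s => w; case: (sP w (s w)) => _ /(_ erefl) [].
Qed.

Lemma fin_dim_surj V W (f : {linear V -> W}) :
  (forall w, exists v, f v = w) -> fin_dim V -> fin_dim W.
Proof.
by move=> /linear_section_exists [s /can_inj s_inj]; apply: fin_dim_inj s_inj.
Qed.

Lemma fin_dim_prod V W : fin_dim V -> fin_dim W -> fin_dim (V * W)%type.
Proof.
move=> [m [[f flin [f' fK f'K]]]] [n [[g glin [g' gK g'K]]]].
exists (m + n)%N; constructor.
exists (fun x : V * W => row_mx (f x.1) (g x.2)).
  by move=> c x y; rewrite /= flin glin scale_row_mx add_row_mx.
exists (fun u => (f' (lsubmx u), g' (rsubmx u))) => [[v w]|u] /=.
  by rewrite row_mxKl row_mxKr fK gK.
by rewrite f'K g'K hsubmxK.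
Qed.

Lemma fin_dim_coordinates V : fin_dim V ->
  exists n (e : 'I_n -> V) (c : 'I_n -> {linear V -> k^o}),
    forall v, v = \sum_(i < n) c i v *: e i.
Proof.
move=> [n [[f flin [f' fK f'K]]]]; exists n.
have clin i : exists c : {linear V -> k^o}, forall v, c v = f v 0 i.
  by apply: linear_bundle => c v w; rewrite flin !mxE.
have [g gE] := linear_bundle flin.
exists (fun i => f' (delta_mx 0 i)), (fun i => projT1 (cid (clin i))) => v.
apply: (can_inj fK); rewrite -!gE linear_sum /= gE [LHS]row_sum_delta.
by apply: eq_bigr => i _; case: cid => c /= ->; rewrite linearZ /= !gE f'K.
Qed.

(** Compactness of linear systems: [P i] is the set of solutions of the [i]-th
    finite part of a system of equations [phi v = c].  The pairs [(v, c)] imposed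
    by some part form a linear relation; it is single-valued because every part
    is solvable, and any linear extension of it solves all the equations. *)
Lemma linear_system_compact V (I : Type) (P : I -> {linear V -> k^o} -> Prop) :
  (exists i : I, True) ->
  (forall i j, exists l, forall psi, P l psi -> P i psi /\ P j psi) ->
  (forall i, exists psi, P i psi) ->
  exists phi : {linear V -> k^o},
    forall i v c, (forall psi, P i psi -> psi v = c) -> phi v = c.
Proof.
move=> [i0 _] Pdir Pex.
pose H v c := exists i, forall psi, P i psi -> psi v = c.
have [||phi phiP] := @linear_relation_extend V k^o H; last first.
- by exists phi => i v c Pvc; apply: phiP; exists i.
- by move=> c [i Pc]; have [psi /Pc <-] := Pex i; rewrite linear0.
split=> [|c v w v' w' [i Pi] [j Pj]]; first by exists i0 => psi _; rewrite linear0.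
have [l lP] := Pdir i j; exists l => psi /lP [/Pi <- /Pj <-].
by rewrite linearP.
Qed.

End LinearAlgebra.

(** * Submodules, quotients and factorizations *)
Section Modules.
Context (k : fieldType) (A : kcat k).
Implicit Types M N X Y Z : kmod A.

Definition minj M N (f : mhom M N) : Prop := forall a, injective (f a).

Definition msurj M N (f : mhom M N) : Prop := forall a y, exists x, f a x = y.

Lemma mhom_bundle M N (s : forall a, M a -> N a) :
  (forall a, linear (s a)) ->
  (forall a b (u : Hom a b) x, s b (act M u x) = act N u (s a x)) ->
  exists f : mhom M N, forall a x, f a x = s a x.
Proof.
move=> slin snat.
pose f a : {linear M a -> N a} := projT1 (cid (linear_bundle (slin a))).
have fE a x : f a x = s a x by rewrite /f; case: cid.
have fnat a b (u : Hom a b) x : f b (act M u x) = act N u (f a x).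
  by rewrite !fE snat.
by exists (MHom fnat).
Qed.

(** A diagram chase yields a relation between elements; this lemma turns it into
    a morphism. *)
Lemma mhom_relation M N (R : forall a, M a -> N a -> Prop) :
  (forall a, linear_relation (R a)) ->
  (forall a y, R a 0 y -> y = 0) ->
  (forall a x, exists y, R a x y) ->
  (forall a b (u : Hom a b) x y, R a x y -> R b (act M u x) (act N u y)) ->
  exists f : mhom M N, forall a x y, R a x y <-> f a x = y.
Proof.
move=> Rlin Rfun Rtot Rnat.
have gex a := linear_relation_map (Rlin a) (Rfun a) (Rtot a).
pose g a : {linear M a -> N a} := projT1 (cid (gex a)).
have gP a x y : R a x y <-> g a x = y by rewrite /g; case: cid.
have gnat a b (u : Hom a b) x : g b (act M u x) = act N u (g a x).
  by apply/gP/Rnat/gP.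
by exists (MHom gnat) => a x y; rewrite gP.
Qed.

Lemma factor_inj N M X (i : mhom N M) (h : mhom X M) :
  minj i -> (forall a x, exists y, i a y = h a x) ->
  exists u : mhom X N, forall a x, i a (u a x) = h a x.
Proof.
move=> i_inj hi.
have [||//||u uP] := @mhom_relation X N (fun a x y => i a y = h a x).
- by move=> a; split=> [|c v w v' w' E E']; rewrite ?linear0 // !linearP E E'.
- by move=> a y; rewrite linear0 -(linear0 (i a)) => /i_inj.
- by move=> a b u x y E; rewrite !mhom_nat E.
by exists u => a x; apply/uP.
Qed.

Lemma factor_surj M N X (q : mhom M N) (h : mhom M X) :
  msurj q -> (forall a x, q a x = 0 -> h a x = 0) ->
  exists u : mhom N X, forall a x, u a (q a x) = h a x.
Proof.
move=> q_surj hq.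
have [||||u uP] := @mhom_relation N X (fun a y z => exists2 x, q a x = y & h a x = z).
- move=> a; split=> [|c v w v' w' [x <- <-] [x' <- <-]].
    by exists 0; rewrite linear0.
  by exists (c *: x + x'); rewrite linearP.
- by move=> a y [x /hq -> ->].
- by move=> a y; have [x <-] := q_surj a y; exists (h a x), x.
- by move=> a b u _ _ [x <- <-]; exists (act M u x); rewrite mhom_nat.
by exists u => a x; apply/uP; exists x.
Qed.

Lemma mhom_sub M N (f g : mhom M N) :
  exists h : mhom M N, forall a x, h a x = f a x - g a x.
Proof.
apply: mhom_bundle => [a c x y|a b u x]; last by rewrite !mhom_nat linearB.
by rewrite !linearP scalerDr addrACA.
Qed.

Definition submodule M (S : forall a, M a -> Prop) : Prop :=
  (forall a, subspace (S a)) /\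
  forall a b (u : Hom a b) x, S a x -> S b (act M u x).

Lemma submodule_exists M (S : forall a, M a -> Prop) : submodule S ->
  exists (N : kmod A) (i : mhom N M),
    minj i /\ forall a y, S a y <-> exists x, i a x = y.
Proof.
move=> [Ssub Sact].
have D a : {U : lmodType k & {i : {linear U -> M a} |
    injective i /\ forall y, S a y <-> exists x, i x = y}}.
  by have /cid [U /cid [i iP]] := subspace_exists (Ssub a); exists U, i.
pose U a := projT1 (D a); pose i a : {linear U a -> M a} := sval (projT2 (D a)).
have i_inj a : injective (i a) := (svalP (projT2 (D a))).1.
have iS a : forall y, S a y <-> exists x, i a x = y := (svalP (projT2 (D a))).2.
have tex a b (u : Hom a b) :
    exists t : {linear U a -> U b}, forall x, i b (t x) = act M u (i a x).
  have [|||t tP] := @linear_relation_map _ (U a) (U b)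
    (fun x y => i b y = act M u (i a x)).
  - by split=> [|c v w v' w' E E']; rewrite ?linear0 // !linearP E E'.
  - by move=> y; rewrite !linear0 -(linear0 (i b)) => /i_inj.
  - by move=> x; apply/iS/Sact/iS; exists x.
  by exists t => x; apply/tP.
pose t a b (u : Hom a b) : {linear U a -> U b} := projT1 (cid (tex a b u)).
have tE a b (u : Hom a b) x : i b (t a b u x) = act M u (i a x).
  by rewrite /t; case: cid.
have t_id a x : t a a (idm a) x = x by apply: i_inj; rewrite tE act_id.
have t_comp a b c (g : Hom b c) (f : Hom a b) x :
    t a c (comp g f) x = t b c g (t a b f x).
  by apply: i_inj; rewrite !tE act_comp.
have t_lin a b (x : U a) : linear (fun f : Hom a b => t a b f x).
  by move=> c f g; apply: i_inj; rewrite linearP !tE act_linear.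
pose N := KMod t_id t_comp t_lin.
have i_nat (a b : A) (u : Hom a b) (x : N a) :
  i b (act N u x) = act M u (i a x) by exact: tE.
by exists N, (MHom i_nat).
Qed.

Lemma quotient_exists M (S : forall a, M a -> Prop) : submodule S ->
  exists (N : kmod A) (pi : mhom M N),
    msurj pi /\ forall a x, S a x <-> pi a x = 0.
Proof.
move=> [Ssub Sact].
have D a : {U : lmodType k & {p : {linear M a -> U} |
    (forall y, exists x, p x = y) /\ forall y, S a y <-> p y = 0}}.
  by have /cid [U /cid [p pP]] := quotient_space_exists (Ssub a); exists U, p.
pose U a := projT1 (D a); pose p a : {linear M a -> U a} := sval (projT2 (D a)).
have p_surj a : forall y, exists x, p a x = y := (svalP (projT2 (D a))).1.
have pS a : forall y, S a y <-> p a y = 0 := (svalP (projT2 (D a))).2.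
have tex a b (u : Hom a b) :
    exists t : {linear U a -> U b}, forall x, t (p a x) = p b (act M u x).
  have [|||t tP] := @linear_relation_map _ (U a) (U b)
    (fun y z => exists2 x, p a x = y & p b (act M u x) = z).
  - split=> [|c v w v' w' [x <- <-] [x' <- <-]]; first by exists 0; rewrite !linear0.
    by exists (c *: x + x'); rewrite !linearP.
  - by move=> y [x /pS /(Sact _ _ u) /pS -> ->].
  - by move=> y; have [x <-] := p_surj a y; exists (p b (act M u x)), x.
  by exists t => x; apply/tP; exists x.
pose t a b (u : Hom a b) : {linear U a -> U b} := projT1 (cid (tex a b u)).
have tE a b (u : Hom a b) x : t a b u (p a x) = p b (act M u x).
  by rewrite /t; case: cid.
have t_id a x : t a a (idm a) x = x.
  by have [y <-] := p_surj a x; rewrite tE act_id.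
have t_comp a b c (g : Hom b c) (f : Hom a b) x :
    t a c (comp g f) x = t b c g (t a b f x).
  by have [y <-] := p_surj a x; rewrite !tE act_comp.
have t_lin a b (x : U a) : linear (fun f : Hom a b => t a b f x).
  by move=> c f g; have [y <-] := p_surj a x; rewrite !tE act_linear linearP.
pose N := KMod t_id t_comp t_lin.
have p_nat (a b : A) (u : Hom a b) (x : M a) :
  p b (act M u x) = act N u (p a x) by rewrite -tE.
by exists N, (@MHom k A M N p p_nat).
Qed.

Lemma ker_submodule M N (f : mhom M N) : submodule (fun a x => f a x = 0).
Proof.
split=> [a|a b u x fx]; last by rewrite mhom_nat fx linear0.
by split=> [|c v w fv fw]; rewrite ?linear0 // linearP fv fw scaler0 addr0.
Qed.

Lemma image_submodule M N (f : mhom M N) :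
  submodule (fun a y => exists x, f a x = y).
Proof.
split=> [a|a b u _ [x <-]]; last by exists (act M u x); rewrite mhom_nat.
split=> [|c _ _ [v <-] [w <-]]; first by exists 0; rewrite linear0.
by exists (c *: v + w); rewrite linearP.
Qed.

Lemma image_factorization M N (f : mhom M N) :
  exists (J : kmod A) (e : mhom M J) (i : mhom J N),
    [/\ msurj e, minj i & forall a x, i a (e a x) = f a x].
Proof.
have [J [i [i_inj iP]]] := submodule_exists (image_submodule f).
have [|e eE] := factor_inj (h := f) i_inj.
  by move=> a x; apply/iP; exists x.
exists J, e, i; split=> // a y; have [x xE] : exists x, f a x = i a y by apply/iP; exists y.
by exists x; apply: i_inj; rewrite eE.
Qed.

Lemma surj_epi C M N (f : mhom M N) : msurj f -> epi_in C f.
Proof.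
by move=> f_surj X _ u v uv a y; have [x <-] := f_surj a y; have := uv a x.
Qed.

Lemma inj_mono C M N (f : mhom M N) : minj f -> mono_in C f.
Proof. by move=> f_inj X _ u v uv a x; apply: f_inj; exact: (uv a x). Qed.

(** Test the epimorphism on the projection to the quotient by its image. *)
Lemma epi_surj M N (f : mhom M N) : epi_in any_module f -> msurj f.
Proof.
move=> fepi a y; have [Q [pi [_ piP]]] := quotient_exists (image_submodule f).
apply/piP; have -> : pi a y = mzero N Q a y; last by [].
by apply: fepi => // b x /=; apply/piP; exists x.
Qed.

Lemma lfd_inj M N (f : mhom M N) : minj f -> locally_fd N -> locally_fd M.
Proof. by move=> f_inj Nfd a; apply: fin_dim_inj (f_inj a) (Nfd a). Qed.

Lemma lfd_surj M N (f : mhom M N) : msurj f -> locally_fd M -> locally_fd N.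
Proof. by move=> f_surj Mfd a; apply: fin_dim_surj (f_surj a) (Mfd a). Qed.

Lemma lfd_sum M N : locally_fd M -> locally_fd N -> locally_fd (sum_mod M N).
Proof. by move=> Mfd Nfd a; exact: fin_dim_prod. Qed.

Lemma sum_copair M N X (f : mhom M X) (g : mhom N X) :
  exists h : mhom (sum_mod M N) X, forall a x, h a x = f a x.1 + g a x.2.
Proof.
apply: (@mhom_bundle (sum_mod M N)) => [a c x y|a b u x] /=.
  by rewrite !linearP scalerDr addrACA.
by rewrite !mhom_nat linearD.
Qed.

Lemma sum_components M N X (h : mhom (sum_mod M N) X) :
  exists (f : mhom M X) (g : mhom N X), forall a x, h a x = f a x.1 + g a x.2.
Proof.
have [||f fE] := @mhom_bundle M X (fun a x => h a (x, 0)).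
- by move=> a c x y; rewrite -linearP; congr (h a (_, _)); rewrite /= scaler0 addr0.
- by move=> a b u x; rewrite -mhom_nat /= /sum_act /= linear0.
have [||g gE] := @mhom_bundle N X (fun a x => h a (0, x)).
- by move=> a c x y; rewrite -linearP; congr (h a (_, _)); rewrite /= scaler0 addr0.
- by move=> a b u x; rewrite -mhom_nat /= /sum_act /= linear0.
exists f, g => a [x y]; rewrite fE gE -linearD; congr (h a (_, _)) => /=.
  by rewrite addr0.
by rewrite add0r.
Qed.

(** * Finitely generated and finitely presented modules *)
Fixpoint all_in M (S : forall a, M a -> Prop) (xs : seq {a : A & M a}) : Prop :=
  if xs is x :: xs' then S (projT1 x) (projT2 x) /\ all_in S xs' else True.

(** The smallest submodule containing the list, given by its universal property
    so that an inclusion is proved by exhibiting a submodule. *)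
Definition span M (xs : seq {a : A & M a}) (b : A) (y : M b) : Prop :=
  forall S : forall a, M a -> Prop, submodule S -> all_in S xs -> S b y.
Arguments span {M} xs b y.

(** Elementwise form of finite generation; see [generatedP]. *)
Definition generated M : Prop := exists xs, forall b (y : M b), span xs b y.

Definition mhom_map M N (f : mhom M N) (x : {a : A & M a}) : {a : A & N a} :=
  existT _ (projT1 x) (f _ (projT2 x)).

Lemma span_submodule M (xs : seq {a : A & M a}) : submodule (span xs).
Proof.
split=> [a|a b u x sx S Ssub Sxs]; last by apply: Ssub.2; exact: sx.
split=> [S Ssub _|c v w sv sw S Ssub Sxs]; first exact: (Ssub.1 a).1.
by apply: (Ssub.1 a).2; [exact: sv|exact: sw].
Qed.

Lemma all_in_cat M (S : forall a, M a -> Prop) xs ys :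
  all_in S (xs ++ ys) <-> all_in S xs /\ all_in S ys.
Proof. by elim: xs => [|x xs IH] /=; [tauto | rewrite IH; tauto]. Qed.

Lemma all_in_true M (S : forall a, M a -> Prop) xs : (forall a x, S a x) -> all_in S xs.
Proof. by move=> ST; elim: xs. Qed.

Lemma all_in_sub M (S T : forall a, M a -> Prop) xs :
  (forall a x, S a x -> T a x) -> all_in S xs -> all_in T xs.
Proof. by move=> ST; elim: xs => //= x xs IH [/ST Tx /IH]. Qed.

Lemma all_in_span M (xs : seq {a : A & M a}) : all_in (span xs) xs.
Proof.
(* Generalized to a list [ys] constrained by [xs], so that induction on [ys] applies. *)
suff H ys : (forall S, all_in S xs -> all_in S ys) -> all_in (span xs) ys.
  exact: H.
elim: ys => //= y ys IH H; split; first by move=> S _ /H [].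
by apply: IH => S /H [].
Qed.

Lemma all_in_map M N (f : mhom M N) (S : forall a, N a -> Prop) xs :
  all_in S (map (mhom_map f) xs) <-> all_in (fun a x => S a (f a x)) xs.
Proof. by elim: xs => //= x xs ->. Qed.

Lemma preimage_submodule M N (f : mhom M N) (S : forall a, N a -> Prop) :
  submodule S -> submodule (fun a x => S a (f a x)).
Proof.
move=> Ssub; split=> [a|a b u x Sx]; last by rewrite mhom_nat; exact: Ssub.2.
split=> [|c v w Sv Sw]; first by rewrite linear0; exact: (Ssub.1 a).1.
by rewrite linearP; exact: (Ssub.1 a).2.
Qed.

Lemma span_map M N (f : mhom M N) xs b y :
  span (map (mhom_map f) xs) b y <-> exists2 x, span xs b x & f b x = y.
Proof.
split=> [sy|[x sx <-] S Ssub Sxs].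
  apply: (sy (fun a y => exists2 x, span xs a x & f a x = y)); last first.
    by apply/all_in_map; apply: all_in_sub (all_in_span xs) => a x sx; exists x.
  split=> [a|a c u _ [x sx <-]]; last first.
    by exists (act M u x); rewrite ?mhom_nat //; exact: (span_submodule _).2.
  split=> [|c _ _ [v sv <-] [w sw <-]].
    by exists 0; rewrite ?linear0 //; exact: ((span_submodule _).1 _).1.
  by exists (c *: v + w); rewrite ?linearP //; exact: ((span_submodule _).1 _).2.
by apply: (sx (fun a x => S a (f a x))); [exact: preimage_submodule|exact/all_in_map].
Qed.

Lemma generated_surj M N (f : mhom M N) : msurj f -> generated M -> generated N.
Proof.
move=> f_surj [xs xsP]; exists (map (mhom_map f) xs) => b y.
by have [x <-] := f_surj b y; apply/span_map; exists x.
Qed.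

Lemma all_in_lift M N (f : mhom M N) (S : forall a, M a -> Prop) ys :
  all_in (fun a y => exists2 x, S a x & f a x = y) ys ->
  exists2 xs, all_in S xs & map (mhom_map f) xs = ys.
Proof.
elim: ys => [|[a y] ys IH] /=; first by exists [::].
move=> [[x Sx <-] /IH [xs Sxs <-]]; exists (existT _ a x :: xs) => //.
Qed.

Lemma span_cat M (xs ys : seq {a : A & M a}) b x y :
  span xs b x -> span ys b y -> span (xs ++ ys) b (x + y).
Proof.
move=> sx sy S Ssub /all_in_cat [Sxs Sys].
by rewrite -[x]scale1r; apply: (Ssub.1 b).2; [exact: sx|exact: sy].
Qed.

Lemma generated_zero : generated (zero_mod A).
Proof. by exists [::] => b y S [+ _] _ => /(_ b) [+ _]; congr (S b); apply/rowP; case. Qed.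

Lemma generated_repr a : generated (repr_mod a).
Proof.
exists [:: existT _ a (idm a : repr_mod a a)] => b y S [_ Sact] /= [Sid _].
by have := Sact _ _ y _ Sid; rewrite /= comp_idr.
Qed.

Lemma sum_inl M N : exists i : mhom M (sum_mod M N), forall a x, i a x = (x, 0).
Proof.
apply: (@mhom_bundle M (sum_mod M N)) => [a c x y|a b u x].
  by congr (_, _); rewrite /= scaler0 addr0.
by rewrite /= /sum_act /= linear0.
Qed.

Lemma sum_inr M N : exists i : mhom N (sum_mod M N), forall a x, i a x = (0, x).
Proof.
apply: (@mhom_bundle N (sum_mod M N)) => [a c x y|a b u x].
  by congr (_, _); rewrite /= scaler0 addr0.
by rewrite /= /sum_act /= linear0.
Qed.

Lemma generated_sum M N : generated M -> generated N -> generated (sum_mod M N).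
Proof.
move=> [xs xsP] [ys ysP]; have [i iE] := sum_inl M N; have [j jE] := sum_inr M N.
exists (map (mhom_map i) xs ++ map (mhom_map j) ys) => b [x y].
have -> : (x, y) = i b x + j b y by rewrite iE jE; congr (_, _) => /=; rewrite ?addr0 ?add0r.
by apply: span_cat; apply/span_map; [exists x|exists y].
Qed.

Lemma generated_free s : generated (direct_sum (map (@repr_mod k A) s)).
Proof.
elim: s => [|a s IH] /=; first exact: generated_zero.
by apply: generated_sum => //; exact: generated_repr.
Qed.

Lemma yoneda M a (x : M a) : exists h : mhom (repr_mod a) M, forall b u, h b u = act M u x.
Proof.
apply: (@mhom_bundle (repr_mod a) M) => [b c u v|b c u v] /=.
  exact: act_linear.
exact: act_comp.
Qed.

Lemma free_cover M (xs : seq {a : A & M a}) :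
  exists p : mhom (direct_sum (map (@repr_mod k A) (map (@projT1 _ _) xs))) M,
    forall b y, span xs b y <-> exists x, p b x = y.
Proof.
suff [p pS] : exists p : mhom (direct_sum (map (@repr_mod k A) (map (@projT1 _ _) xs))) M,
    (forall b x, span xs b (p b x)) /\ all_in (fun b y => exists x, p b x = y) xs.
  exists p => b y; split=> [sy|[x <-]]; last exact: pS.1.
  exact: sy (image_submodule p) pS.2.
elim: xs => [|[a x] xs [p [pS pxs]]] /=.
  exists (mzero _ M); split=> // b x; exact: ((span_submodule _).1 _).1.
have [h hE] := yoneda x; have [g gE] := sum_copair h p.
exists g; split=> [b y|].
  move=> S Ssub [Sx Sxs]; rewrite gE -[h b _]scale1r; apply: (Ssub.1 b).2.
    by rewrite hE; exact: Ssub.2.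
  exact: pS.
split; first by exists (idm a, 0); rewrite gE linear0 hE act_id addr0.
by apply: all_in_sub pxs => b y [z <-]; exists (0, z); rewrite gE linear0 add0r.
Qed.

Lemma generatedP M : finitely_generated M <-> generated M.
Proof.
split=> [[s [p /epi_surj p_surj]]|[xs xsP]].
  exact: generated_surj p_surj (generated_free s).
have [p pE] := free_cover xs; exists (map (@projT1 _ _) xs), p.
by apply: surj_epi => b y; apply/pE.
Qed.

Lemma finitely_presentedI C s (q : mhom (direct_sum (map (@repr_mod k A) s)) C) ys :
  msurj q -> all_in (fun a x => q a x = 0) ys ->
  (forall a x, q a x = 0 -> span ys a x) -> finitely_presented C.
Proof.
move=> q_surj qys ysP; have [K [i [i_inj iP]]] := submodule_exists (ker_submodule q).
exists s, q; split; first exact: surj_epi.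
exists K, i; split.
  split=> // [a x|X _ h qh]; first by apply/iP; exists x.
  have [|u uE] := factor_inj (h := h) i_inj.
    by move=> a x; apply/iP; exact: (qh a x).
  by exists u; split=> // v vE a x; apply: i_inj; rewrite uE; exact: (vE a x).
have [p pE] := free_cover ys.
have [|e eE] := factor_inj (h := p) i_inj.
  move=> a x; apply/iP; have sp : span ys a (p a x) by apply/pE; exists x.
  exact: sp (ker_submodule q) qys.
exists (map (@projT1 _ _) ys), e; apply: surj_epi => a x.
have /ysP/pE [y yE] : q a (i a x) = 0 by apply/iP; exists x.
by exists y; apply: i_inj; rewrite eE.
Qed.

End Modules.

Arguments span {k A M} xs b y.

(** * Sections over finitely many objects *)
Section Compactness.
Context (k : fieldType) (A : kcat k).
Implicit Types M C : kmod A.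

Definition partial_section M C (p : mhom M C) (F : seq {classic A})
    (s : forall a, C a -> M a) : Prop :=
  forall a : A, (a : {classic A}) \in F ->
    [/\ linear (s a), forall x, p a (s a x) = x
      & forall b : A, (b : {classic A}) \in F ->
        forall (u : Hom a b) x, s b (act C u x) = act M u (s a x)].

(** The unknowns are the coordinates of the values [s a x].  Linearity,
    naturality and [p (s x) = x] are linear equations, each involving finitely
    many unknowns and at most two objects. *)
Lemma section_compact M C (p : mhom M C) :
  locally_fd M -> locally_fd C ->
  (forall F, exists s, partial_section p F s) ->
  exists s : mhom C M, forall a x, p a (s a x) = x.
Proof.
move=> Mfd Cfd p_sect.
have D a : {n & {e : 'I_n -> M a & {c : 'I_n -> {linear M a -> k^o} |
    forall v, v = \sum_(i < n) c i v *: e i}}}.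
  by have /cid [n /cid [e /cid [c cP]]] := fin_dim_coordinates (Mfd a); exists n, e, c.
pose n a := projT1 (D a); pose e a : 'I_(n a) -> M a := projT1 (projT2 (D a)).
pose c a : 'I_(n a) -> {linear M a -> k^o} := sval (projT2 (projT2 (D a))).
have cP a v : v = \sum_(i < n a) c a i v *: e a i := svalP (projT2 (projT2 (D a))) v.
(* [E a x j] is the unknown for the [j]-th coordinate of [s a x]. *)
pose T := {classic {a : A & (C a * 'I_(n a))%type}}.
pose E a (x : C a) j : {malg k[T]} := << (existT _ a (x, j) : T) >>.
pose P F (psi : {linear {malg k[T]} -> k^o}) :=
  exists s, partial_section p F s /\ forall a x j, psi (E a x j) = c a j (s a x).
have [||F|phi phiP] := @linear_system_compact k {malg k[T]} _ P.
- by exists [::].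
- move=> F F'; exists (F ++ F') => psi [s [sP sE]].
  by split; exists s; split=> // a aF; have [|? ? nat] := sP a; rewrite ?mem_cat ?aF ?orbT //;
    split=> // b bF; apply: nat; rewrite mem_cat bF ?orbT.
- have [s sP] := p_sect F.
  exists (lin_ext (fun t : T => c _ (projT2 t).2 (s _ (projT2 t).1))).
  by exists s; split=> // a x j; exact: lin_extU.
have phiE F v w : (forall psi, P F psi -> psi v = psi w) -> phi v = phi w.
  move=> vw; apply/eqP; rewrite -subr_eq0 -linearB; apply/eqP.
  by apply: (phiP F) => psi /vw E0; rewrite linearB /= E0 subrr.
pose s a (x : C a) : M a := \sum_(j < n a) phi (E a x j) *: e a j.
(* [Ev a g x] is the combination of unknowns whose value is [g (s a x)]. *)
pose Ev a (g : {linear M a -> k^o}) x := \sum_(i < n a) g (e a i) *: E a x i.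
have phiEv a g (x : C a) : phi (Ev a g x) = g (s a x).
  by rewrite !linear_sum; apply: eq_bigr => i _; rewrite !linearZ; exact: mulrC.
have psiEv a g (x : C a) (psi : {linear {malg k[T]} -> k^o}) (t : forall a, C a -> M a) :
    (forall a x j, psi (E a x j) = c a j (t a x)) -> psi (Ev a g x) = g (t a x).
  move=> psiE; rewrite [in RHS](cP a (t a x)) !linear_sum.
  by apply: eq_bigr => i _; rewrite !linearZ /= psiE; exact: mulrC.
have [||s' s'E] := @mhom_bundle _ _ C M s.
- move=> a d x y; rewrite /s scaler_sumr -big_split; apply: eq_bigr => j _ /=.
  rewrite scalerA -scalerDl; congr (_ *: _).
  have -> : d * phi (E a x j) + phi (E a y j) = phi (d *: E a x j + E a y j).
    by rewrite linearP.
  apply: (phiE [:: a]) => psi [t [tP tE]].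
  have [|tlin _ _] := tP a; first exact: mem_head.
  by rewrite linearP /= !tE tlin linearP.
- move=> a b u x; rewrite [RHS](cP b); apply: eq_bigr => j _; congr (_ *: _).
  pose g : {linear M a -> k^o} := c b j \o act M u.
  have <- : phi (Ev a g x) = c b j (act M u (s a x)) by exact: phiEv.
  apply: (phiE [:: a; b]) => psi [t [tP tE]].
  rewrite (psiEv _ _ _ _ _ tE) /= tE.
  have [|_ _ ->//] := tP a; first exact: mem_head.
  by rewrite !inE eqxx orbT.
exists s' => a x; rewrite s'E.
have [m [f [g gP]]] := fin_dim_coordinates (Cfd a).
rewrite [LHS]gP [RHS]gP; apply: eq_bigr => j _; congr (_ *: _).
pose h : {linear M a -> k^o} := g j \o p a.
have <- : phi (Ev a h x) = g j (p a (s a x)) by exact: phiEv.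
apply: (phiP [:: a]) => psi [t [tP tE]].
rewrite (psiEv _ _ _ _ _ tE) /=.
by have [|_ -> _] := tP a; first exact: mem_head.
Qed.

End Compactness.

Section SpanningLists.
Context (k : fieldType) (A : kcat k).
Implicit Types M : kmod A.

(** Since the generators live at objects of [D], a morphism that vanishes at these
    objects kills the whole span. *)
Lemma lfd_spanning M (D : A -> Prop) (F : seq {classic A}) : locally_fd M ->
  exists xs : seq {a : A & M a}, all_in (fun a _ => D a) xs /\
    forall a : A, (a : {classic A}) \in F -> D a -> forall x : M a, span xs a x.
Proof.
move=> Mfd; elim: F => [|a F [xs [Dxs xsP]]]; first by exists [::].
have [Da|nDa] := pselect (D a); last first.
  exists xs; split=> // b; rewrite inE => /predU1P [->//|]; exact: xsP.
have [n [e [c cP]]] := fin_dim_coordinates (Mfd a).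
pose es := [seq existT (fun a => M a) a (e i) | i <- enum 'I_n].
have all_es (S : forall a, M a -> Prop) : all_in S es <-> forall i, S a (e i).
  have {}all_es s : all_in S [seq existT (fun a => M a) a (e i) | i <- s] <->
      forall i, i \in s -> S a (e i).
    elim: s => [|i s IH] //=; rewrite IH; split=> [[Si Ss] j|Ss].
      by rewrite inE => /predU1P [->//|]; exact: Ss.
    by split=> [|j js]; apply: Ss; rewrite inE ?eqxx // js orbT.
  rewrite all_es; split=> [+ i|+ i _]; apply => //; exact: mem_enum.
exists (es ++ xs); split; first by apply/all_in_cat; split=> //; apply/all_es.
move=> b; rewrite inE => /predU1P [-> _|bF Db] x S Ssub /all_in_cat [Ses Sxs].
  have /all_es {}Ses := Ses; rewrite (cP x).
  elim/big_ind: _ => [|v w Sv Sw|i _]; first exact: (Ssub.1 _).1.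
    by rewrite -[v]scale1r; apply: (Ssub.1 _).2.
  by rewrite -[_ *: _]addr0; apply: (Ssub.1 _).2 => //; exact: (Ssub.1 _).1.
exact: xsP bF Db x S Ssub Sxs.
Qed.

End SpanningLists.

(** * Cokernels of irreducible monomorphisms *)
Section Sequences.
Context (k : fieldType) (A : kcat k).
Implicit Types L M C P D X : kmod A.

Definition short_exact L M C (f : mhom L M) (p : mhom M C) : Prop :=
  [/\ minj f, msurj p & forall a y, p a y = 0 <-> exists x, f a x = y].

(** By the Yoneda lemma elements are morphisms from representables, which are
    locally finite dimensional. *)
Lemma mono_inj L M (f : mhom L M) :
  (forall a : A, locally_fd (repr_mod a)) -> mono_in locally_fd f -> minj f.
Proof.
move=> Pfd f_mono a x y fxy.
have [u uE] := yoneda x; have [v vE] := yoneda y.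
suff /(_ a (idm a)) : u =m v by rewrite uE vE !act_id.
by apply: (f_mono _ (Pfd a)) => b w /=; rewrite uE vE !mhom_nat fxy.
Qed.

(** The universal property is tested on [M/f(L)] for exactness in the middle,
    and on [C/p(M)] for surjectivity; both are locally finite dimensional. *)
Lemma cokernel_exact L M C (f : mhom L M) (p : mhom M C) :
  minj f -> locally_fd M -> cokernel_in locally_fd f p -> short_exact f p.
Proof.
move=> f_inj Mfd [Cfd pf0 p_univ]; split=> // [a y|a y].
  have [Q [pi [pi_surj piP]]] := quotient_exists (image_submodule p).
  have [|u [_ uP]] := p_univ _ (lfd_surj pi_surj Cfd) (mzero M Q).
    by move=> b x /=.
  apply/piP; rewrite (uP pi); last by move=> b x /=; apply/piP; exists x.
  by rewrite -(uP (mzero C Q)).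
split=> [py0|[x <-]]; last exact: (pf0 a x).
have [Q [pi [pi_surj piP]]] := quotient_exists (image_submodule f).
have [|u [uE _]] := p_univ _ (lfd_surj pi_surj Mfd) pi.
  by move=> b x /=; apply/piP; exists x.
by apply/piP; rewrite -(uE a y) /= py0 linear0.
Qed.

Definition quotient_by P D (pi : mhom P D) (ys : seq {a : A & P a}) : Prop :=
  msurj pi /\ forall a x, pi a x = 0 <-> span ys a x.

Lemma quotient_by_exists P C (q : mhom P C) ys :
  all_in (fun a x => q a x = 0) ys ->
  exists D (pi : mhom P D) (h : mhom D C),
    quotient_by pi ys /\ forall a x, h a (pi a x) = q a x.
Proof.
move=> qys; have [D [pi [pi_surj piP]]] := quotient_exists (span_submodule ys).
have [|h hE] := factor_surj (h := q) pi_surj.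
  by move=> a x /piP sx; exact: sx (ker_submodule q) qys.
by exists D, pi, h; do 2!split=> //; move=> a x; rewrite piP.
Qed.

(** More of the kernel of [q] can be killed while staying over [C]: a
    factorization of [p] through [P/ys] is pushed along [r] to [P/(ys ++ zs)]. *)
Lemma quotient_by_enlarge P C (q : mhom P C) D (pi : mhom P D) (h : mhom D C) ys zs :
  quotient_by pi ys -> (forall a x, h a (pi a x) = q a x) ->
  all_in (fun a x => q a x = 0) ys -> all_in (fun a x => q a x = 0) zs ->
  exists D' (pi' : mhom P D') (h' : mhom D' C) (r : mhom D D'),
    [/\ quotient_by pi' (ys ++ zs), forall a x, h' a (pi' a x) = q a x,
        forall a x, r a (pi a x) = pi' a x & forall a y, h' a (r a y) = h a y].
Proof.
move=> [pi_surj piP] hE qys qzs.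
have [|D' [pi' [h' [pi'P h'E]]]] := @quotient_by_exists P C q (ys ++ zs).
  by apply/all_in_cat.
have [|r rE] := factor_surj (h := pi') pi_surj.
  by move=> a x /piP sx; apply/pi'P.2 => S Ssub /all_in_cat [Sys _]; exact: sx.
exists D', pi', h', r; split=> // a y.
by have [x <-] := pi_surj a y; rewrite rE h'E hE.
Qed.

(** Modulo [ys], the kernel of [q] is the image of the idempotent [1 - u h], so
    it is generated by the images of the generators of [P]. *)
Lemma kernel_generated_of_section P C (q : mhom P C) D (pi : mhom P D)
    (h : mhom D C) (u : mhom C D) ys :
  generated P -> all_in (fun a x => q a x = 0) ys -> quotient_by pi ys ->
  (forall a x, h a (pi a x) = q a x) -> (forall a y, h a (u a y) = y) ->
  exists zs, all_in (fun a x => q a x = 0) zs /\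
    forall a x, q a x = 0 -> span zs a x.
Proof.
move=> [xs xsP] qys [pi_surj piP] hE hu.
have [e eE] := mhom_sub pi (mcomp u q).
have [|ws qws wsE] := @all_in_lift _ _ _ _ pi (fun a x => q a x = 0) (map (mhom_map e) xs).
  apply/all_in_map/all_in_true => a x; have [z zE] := pi_surj a (e a x).
  by exists z => //; rewrite -hE zE eE linearB hE /= hu subrr.
exists (ys ++ ws); split; first exact/all_in_cat.
move=> a x qx0; have /span_map [z sz piz] : span (map (mhom_map pi) ws) a (e a x).
  by rewrite wsE; apply/span_map; exists x.
rewrite -(subrK z x); apply: span_cat => //; apply/piP.
by rewrite linearB /= piz eE /= qx0 linear0 subr0 subrr.
Qed.

Definition image_generated M N (f : mhom M N) : Prop :=
  exists ws, all_in (fun b y => exists x, f b x = y) ws /\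
    forall b x, span ws b (f b x).

Lemma image_generated_source M N (f : mhom M N) : generated M -> image_generated f.
Proof.
move=> [xs xsP]; exists (map (mhom_map f) xs); split.
  by apply/all_in_map/all_in_true => a x; exists x.
by move=> b x; apply/span_map; exists x.
Qed.

Section Exact.
Context (L M C : kmod A) (f : mhom L M) (p : mhom M C).
Hypothesis fp : short_exact f p.

Let pf0 a x : p a (f a x) = 0.
Proof. by have [_ _ fpP] := fp; apply/fpP; exists x. Qed.

(** Adding to [ys] lifts of the generators of [t (f L)] makes [t] vanish on
    [f L]; it then descends to a section of [P/ys -> C]. *)
Lemma kernel_generated_of_image P (q : mhom P C) D (pi : mhom P D)
    (h : mhom D C) (t : mhom M D) ys :
  generated P -> all_in (fun a x => q a x = 0) ys -> quotient_by pi ys ->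
  (forall a x, h a (pi a x) = q a x) -> (forall a m, h a (t a m) = p a m) ->
  image_generated (mcomp t f) ->
  exists zs, all_in (fun a x => q a x = 0) zs /\
    forall a x, q a x = 0 -> span zs a x.
Proof.
have [f_inj p_surj fpP] := fp.
move=> Pgen qys piP hE ht [ws [wsim wsP]].
have [|zs qzs zsE] := @all_in_lift _ _ _ _ pi (fun a x => q a x = 0) ws.
  apply: all_in_sub wsim => a _ [x <-] /=.
  have [z zE] := piP.1 a (t a (f a x)); exists z => //.
  by rewrite -hE zE ht pf0.
have [D' [pi' [h' [r [pi'P h'E rE hr]]]]] := quotient_by_enlarge piP hE qys qzs.
have [|u uE] := factor_surj (h := mcomp r t) p_surj.
  move=> a m /fpP [x <-] /=.
  have := wsP a x; rewrite -zsE => /span_map [z sz /= <-].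
  by rewrite rE; apply/pi'P.2 => S Ssub /all_in_cat [_ Szs]; exact: sz.
apply: (kernel_generated_of_section (u := u) Pgen _ pi'P h'E).
  exact/all_in_cat.
by move=> a y; have [m <-] := p_surj a y; rewrite uE /= hr ht.
Qed.

Hypothesis f_irr : irreducible_in locally_fd f.

Lemma no_section : ~ exists s : mhom C M, forall a x, p a (s a x) = x.
Proof.
move=> [s sP]; have [f_inj p_surj fpP] := fp; have [_ _ + _ _] := f_irr; apply.
have [d dE] := mhom_sub (mid M) (mcomp s p).
have [|r rE] := factor_inj (h := d) f_inj.
  by move=> a m; apply/fpP; rewrite dE linearB /= sP subrr.
by exists r => a x; apply: f_inj; rewrite /= rE dE /= pf0 linear0 subr0.
Qed.

(** The dichotomy for irreducible monomorphisms.  Let [Y] be the pullback of [h]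
    and [p]; then [f] factors as [L -> Y -> M].  A retraction of [L -> Y] splits
    the pulled back sequence and gives a lift of [h]; a section of [Y -> M]
    composed with [Y -> X] gives the factorization of [p]. *)
Lemma lift_or_factor X (h : mhom X C) : locally_fd X ->
  (exists l : mhom X M, forall a x, p a (l a x) = h a x) \/
  (exists t : mhom M X, forall a m, h a (t a m) = p a m).
Proof.
move=> Xfd; have [f_inj p_surj fpP] := fp; have [Lfd Mfd _ _ f_fact] := f_irr.
have [p1 [p2 [p1E p2E]]] : exists (p1 : mhom (sum_mod X M) X) (p2 : mhom (sum_mod X M) M),
    (forall a z, p1 a z = z.1) /\ (forall a z, p2 a z = z.2).
  have [p1 p1E] := sum_copair (mid X) (mzero M X).
  have [p2 p2E] := sum_copair (mzero X M) (mid M).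
  by exists p1, p2; split=> a z; rewrite (p1E, p2E) /= (addr0, add0r).
have [d dE] := mhom_sub (mcomp h p1) (mcomp p p2).
(* The pullback, as a submodule of [X + M]. *)
have [Y [i [i_inj iP]]] := submodule_exists (ker_submodule d).
have Y_fib a y : h a (i a y).1 = p a (i a y).2.
  have : d a (i a y) = 0 by apply/iP; exists y.
  by rewrite dE /= p1E p2E => /eqP; rewrite subr_eq0 => /eqP.
have Y_ex a x m : h a x = p a m -> exists y, i a y = (x, m).
  by move=> hxpm; apply/iP; rewrite dE /= p1E p2E /= hxpm subrr.
have [j jE] := sum_inr X M.
have [|b bE] := factor_inj (h := mcomp j f) i_inj.
  by move=> a x; rewrite /= jE; apply: Y_ex; rewrite linear0 pf0.
have [|||] := f_fact Y _ b (mcomp p2 i).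
- exact: lfd_inj i_inj (lfd_sum Xfd Mfd).
- by move=> a x /=; rewrite bE p2E /= jE.
- move=> [r rP]; left.
  have [l lE] := mhom_sub (mcomp p2 i) (mcomp f r).
  (* [l y = y.2 - f (r y)] vanishes on [L], hence descends to [X]. *)
  have [||q qE] := @factor_surj _ _ _ X M (mcomp p1 i) l.
  + move=> a x; have [m pm] := p_surj a (h a x).
    by have [|y yE] := @Y_ex a x m; [|exists y; rewrite /= yE p1E].
  + move=> a y /=; rewrite p1E => y10.
    have /fpP [x xE] : p a (i a y).2 = 0 by rewrite -Y_fib y10 linear0.
    have -> : y = b a x.
      by apply: i_inj; rewrite bE /= jE xE -y10; case: (i a y).
    have rb : r a (b a x) = x := rP a x.
    by rewrite lE /= bE rb /= jE p2E subrr.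
  exists q => a x; have [m pm] := p_surj a (h a x).
  have [|y yE] := @Y_ex a x m; first by [].
  have <- : mcomp p1 i a y = x by rewrite /= p1E yE.
  by rewrite qE lE linearB /= pf0 subr0 p1E p2E Y_fib.
- move=> [s sP]; right; exists (mcomp p1 (mcomp i s)) => a m /=.
  by rewrite p1E Y_fib -p2E; congr (p a _); exact: (sP a m).
Qed.

Hypothesis Cfd : locally_fd C.

(** Otherwise the inclusion of every finitely generated submodule lifts to [M],
    since [p] is surjective and cannot factor through a proper submodule; these
    lifts are sections over finite sets of objects. *)
Lemma cokernel_generated : generated C.
Proof.
have [f_inj p_surj fpP] := fp; have [Lfd Mfd _ _ _] := f_irr.
apply: contrapT => Cngen; apply: no_section; apply: section_compact => // F.
have [xs [_ xsP]] := lfd_spanning (fun=> True) F Cfd.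
have [N [i [i_inj iP]]] := submodule_exists (span_submodule xs).
have [[l lP]|[t tP]] := lift_or_factor i (lfd_inj i_inj Cfd); last first.
  by case: Cngen; exists xs => b y; apply/iP; have [m <-] := p_surj b y;
    exists (t b m).
pose s a y : M a :=
  if pselect (exists x, i a x = y) is left yi then l a (projT1 (cid yi)) else 0.
have sE a x : s a (i a x) = l a x.
  rewrite /s; case: pselect => [yi|[]]; last by exists x.
  by case: cid => x' /= /i_inj ->.
have iF a : (a : {classic A}) \in F -> forall y, exists x, i a x = y.
  by move=> aF y; apply/iP; exact: xsP.
exists s => a aF; split=> [c v w|y|b bF u y].
- have [x <-] := iF a aF v; have [x' <-] := iF a aF w.
  by rewrite -linearP !sE linearP.
- by have [x <-] := iF a aF y; rewrite sE lP.
- by have [x <-] := iF a aF y; rewrite -mhom_nat !sE mhom_nat.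
Qed.

(** If the conclusion fails for every list [ys], all the maps [P/ys -> C] lift to
    [M].  For [ys] generating the kernel of [q] at a finite set of objects, [P/ys]
    and [C] agree there, so the lift is a section over this set.  *)
Lemma factor_through_presented P (q : mhom P C) : msurj q -> locally_fd P ->
  exists ys, all_in (fun a x => q a x = 0) ys /\
    forall D (pi : mhom P D) (h : mhom D C), quotient_by pi ys ->
      (forall a x, h a (pi a x) = q a x) ->
      exists t : mhom M D, forall a m, h a (t a m) = p a m.
Proof.
move=> q_surj Pfd; have [_ Mfd _ _ _] := f_irr.
apply: contrapT => noys; apply: no_section; apply: section_compact => // F.
have [K [i [i_inj iP]]] := submodule_exists (ker_submodule q).
have [xs [_ xsP]] := lfd_spanning (fun=> True) F (lfd_inj i_inj Pfd).
pose ys := map (mhom_map i) xs.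
have qys : all_in (fun a x => q a x = 0) ys.
  by apply/all_in_map/all_in_true => a x; apply/iP; exists x.
apply: contrapT => nos; apply: noys; exists ys; split=> // D pi h piP hE.
have [[l lP]|//] := lift_or_factor h (lfd_surj piP.1 Pfd).
case: nos; pose s a y : M a := l a (pi a (projT1 (cid (q_surj a y)))).
have sE a x : (a : {classic A}) \in F -> s a (q a x) = l a (pi a x).
  move=> aF; rewrite /s; case: cid => x' /= x'E; congr (l a _).
  apply/eqP; rewrite -subr_eq0 -linearB; apply/eqP/piP.2.
  have /iP [z <-] : q a (x' - x) = 0 by rewrite linearB /= x'E subrr.
  by apply/span_map; exists z => //; exact: xsP.
exists s => a aF; split=> [c v w|y|b bF u y].
- have [x <-] := q_surj a v; have [x' <-] := q_surj a w.
  by rewrite -linearP !sE // !linearP.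
- by have [x <-] := q_surj a y; rewrite sE // lP hE.
- by have [x <-] := q_surj a y; rewrite -mhom_nat !sE // !mhom_nat.
Qed.

End Exact.
End Sequences.

(** * Projective modules and images of direct sums *)
Section Projectives.
Context (k : fieldType) (A : kcat k).
Implicit Types M N P : kmod A.

Lemma projective_lift P M N (e : mhom M N) (h : mhom P N) :
  projective P -> msurj e -> exists l : mhom P M, forall a x, e a (l a x) = h a x.
Proof.
move=> Pproj e_surj; have [l lP] := Pproj M N e h (@surj_epi _ _ any_module _ _ _ e_surj).
by exists l => a x; exact: (lP a x).
Qed.

Lemma projective_repr a : projective (@repr_mod k A a).
Proof.
move=> M N e h /epi_surj e_surj; have [x ex] := e_surj a (h a (idm a)).
have [l lE] := yoneda x; exists l => b u /=.
by rewrite lE mhom_nat ex -mhom_nat /= comp_idr.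
Qed.

Lemma projective_sum P P' : projective P -> projective P' -> projective (sum_mod P P').
Proof.
move=> Pproj P'proj M N e h eepi; have [f [g hE]] := sum_components h.
have [l lP] := Pproj _ _ e f eepi; have [l' l'P] := P'proj _ _ e g eepi.
have [m mE] := sum_copair l l'; exists m => a x /=.
have le : e a (l a x.1) = f a x.1 := lP a x.1.
have l'e : e a (l' a x.2) = g a x.2 := l'P a x.2.
by rewrite mE linearD le l'e hE.
Qed.

Lemma projective_zero : projective (zero_mod A).
Proof.
move=> M N e h _; exists (mzero _ M) => a x /=.
have -> : x = 0 by apply/rowP; case.
by rewrite !linear0.
Qed.

Lemma projective_free s : projective (direct_sum (map (@repr_mod k A) s)).
Proof.
elim: s => [|a s IH] /=; first exact: projective_zero.
by apply: projective_sum => //; exact: projective_repr.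
Qed.

Lemma lfd_free s : (forall a : A, locally_fd (repr_mod a)) ->
  locally_fd (direct_sum (map (@repr_mod k A) s)).
Proof.
move=> Pfd; elim: s => [|a s IH] /=; last exact: lfd_sum.
by move=> a; exists 0; constructor; exists idfun; last exact: inv_bij.
Qed.

Lemma image_generated_comp M N N' (f : mhom M N) (j : mhom N N') (g : mhom M N') :
  (forall a x, g a x = j a (f a x)) -> image_generated f -> image_generated g.
Proof.
move=> gE [ws [wsim wsP]]; exists (map (mhom_map j) ws); split.
  by apply/all_in_map; apply: all_in_sub wsim => a _ [x <-]; exists x.
by move=> b x; rewrite gE; apply/span_map; exists (f b x).
Qed.

Lemma image_generated_precomp M M' N (e : mhom M' M) (f : mhom M N) :
  msurj e -> image_generated (mcomp f e) -> image_generated f.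
Proof.
move=> e_surj [ws [wsim wsP]]; exists ws; split.
  by apply: all_in_sub wsim => a _ [x <-]; exists (e a x).
by move=> b x; have [x' <-] := e_surj b x; exact: wsP.
Qed.

Lemma image_generated_sum M M' N (h : mhom (sum_mod M M') N) :
  (forall f : mhom M N, image_generated f) ->
  (forall g : mhom M' N, image_generated g) -> image_generated h.
Proof.
move=> Mgen M'gen; have [f [g hE]] := sum_components h.
have [ws [wsim wsP]] := Mgen f; have [ws' [wsim' wsP']] := M'gen g.
exists (ws ++ ws'); split; last by move=> b x; rewrite hE; exact: span_cat.
apply/all_in_cat; split.
  by apply: all_in_sub wsim => a _ [x <-]; exists (x, 0); rewrite hE linear0 addr0.
by apply: all_in_sub wsim' => a _ [x <-]; exists (0, x); rewrite hE linear0 add0r.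
Qed.

Lemma image_generated_direct_sum I (F : I -> kmod A) (s : seq I) N :
  (forall i (f : mhom (F i) N), image_generated f) ->
  forall h : mhom (direct_sum [seq F i | i <- s]) N, image_generated h.
Proof.
move=> Fgen; elim: s => [|i s IH] h /=; first exact/image_generated_source/generated_zero.
exact: image_generated_sum.
Qed.

Lemma split_isomorphic M N (d : mhom M N) (s : mhom N M) K (i : mhom K M) :
  (forall a y, d a (s a y) = y) -> minj i ->
  (forall a x, d a x = 0 <-> exists z, i a z = x) ->
  mod_isomorphic M (sum_mod K N).
Proof.
move=> ds i_inj iP; have di a z : d a (i a z) = 0 by apply/iP; exists z.
have [e eE] := mhom_sub (mid M) (mcomp s d).
have [|r rE] := factor_inj (h := e) i_inj.
  by move=> a x; apply/iP; rewrite eE linearB /= ds subrr.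
have [||f fE] := @mhom_bundle _ _ M (sum_mod K N) (fun a x => (r a x, d a x)).
- by move=> a c x y; rewrite !linearP.
- by move=> a b u x; rewrite /= /sum_act /= !mhom_nat.
have [g gE] := sum_copair i s; exists f, g; split=> a x /=.
  by rewrite fE gE /= rE eE /= subrK.
rewrite fE gE; case: x => z y; congr (_, _) => /=; last first.
  by rewrite linearD /= di ds add0r.
by apply: i_inj; rewrite rE eE /= linearD /= di ds add0r addrK.
Qed.

(** Any property of a list of elements may be strengthened by recording the
    objects at which the elements live. *)
Lemma all_in_tag M (S : forall a, M a -> Prop) (xs : seq {a : A & M a}) :
  all_in S xs ->
  all_in (fun a x =>
    (a : {classic A}) \in [seq (projT1 z : {classic A}) | z <- xs] /\ S a x) xs.
Proof.
elim: xs => //= x xs IH [Sx /IH Sxs]; split; first by rewrite mem_head.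
by apply: all_in_sub Sxs => a y [ay Sy]; rewrite inE ay orbT.
Qed.

End Projectives.

(** * Hereditary categories with finite intervals *)
Section Directed.
Context (k : fieldType) (A : kcat k) (le : A -> A -> Prop).
(** For a path category, [le a b] means that there is a path from [a] to [b]. *)
Hypothesis le_trans : forall a b c, le a b -> le b c -> le a c.
Hypothesis le_refl : forall a, le a a.
Hypothesis le_hom : forall (a b : A) (u : Hom a b), u <> 0 -> le a b.
Hypothesis le_fin : forall a b, exists F : seq {classic A},
  forall c : A, le a c -> le c b -> (c : {classic A}) \in F.
Implicit Types M N P K J : kmod A.

Definition bounded_below N : Prop := exists G : seq {classic A},
  forall (b : A) (x : N b), x <> 0 -> exists2 a : A, (a : {classic A}) \in G & le a b.

Lemma bounded_below_inj M N (i : mhom M N) : minj i -> bounded_below N -> bounded_below M.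
Proof.
move=> i_inj [G GP]; exists G => b x x0; apply: (GP b (i b x)) => ix0; apply: x0.
by apply: i_inj; rewrite ix0 linear0.
Qed.

Lemma bounded_below_surj M N (q : mhom M N) : msurj q -> bounded_below M -> bounded_below N.
Proof.
move=> q_surj [G GP]; exists G => b y y0; have [x xE] := q_surj b y.
by apply: (GP b x) => x0; apply: y0; rewrite -xE x0 linear0.
Qed.

Lemma bounded_below_free s : bounded_below (direct_sum (map (@repr_mod k A) s)).
Proof.
elim: s => [|a s [G GP]] /=; first by exists [::] => b x; case; apply/rowP; case.
exists ((a : {classic A}) :: G) => b [u y] uy0; have [u0|/le_hom ab] := pselect (u = 0).
  have [|a' a'G a'b] := GP b y; first by move=> y0; apply: uy0; rewrite u0 y0.
  by exists a' => //; rewrite inE a'G orbT.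
by exists a => //; exact: mem_head.
Qed.

Lemma act0 M (a b : A) (x : M a) : act M (0 : Hom a b) x = 0.
Proof.
have := act_linear x (-1) (0 : Hom a b) 0.
by rewrite !scaleN1r oppr0 addr0 addNr.
Qed.

(** Let [low] be the set of objects below an element of [B], and [ys] generate [N]
    at these objects; finitely many of them carry a nonzero value of [N].  In any
    module the elements at objects outside [low] form a submodule, and [N/ys]
    lives there.  A map [N/ys -> Y] therefore lifts along the truncation of
    [X -> Y], first on [N]; the lift vanishes at [low] and so kills [ys]. *)
Lemma projective_truncation N (B : seq {classic A}) :
  projective N -> locally_fd N -> bounded_below N ->
  exists ys : seq {a : A & N a},
    (forall b : A, (b : {classic A}) \in B -> forall x : N b, span ys b x) /\
    forall D (pi : mhom N D), quotient_by pi ys -> projective D.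
Proof.
move=> Nproj Nfd [G GP]; pose low (y : A) := exists2 b : A, (b : {classic A}) \in B & le y b.
pose I (a b : {classic A}) : seq {classic A} := projT1 (cid (le_fin a b)).
pose F := flatten [seq flatten [seq I a b | b <- B] | a <- G].
have [ys [ys_low ysP]] := lfd_spanning low F Nfd; exists ys.
have low_span y (x : N y) : low y -> span ys y x.
  move=> ylow; have [->|/GP [a aG ay]] := pselect (x = 0).
    exact: ((span_submodule ys).1 y).1.
  apply: ysP => //; have [b bB yb] := ylow.
  apply/flatten_mapP; exists a => //; apply/flatten_mapP; exists b => //.
  by rewrite /I; case: cid => s /= ->.
split=> [b bB x|D pi [pi_surj piP] X Y e h /epi_surj e_surj].
  by apply: low_span; exists b.
pose top (Z : kmod A) (a : A) (x : Z a) := low a -> x = 0.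
have top_sub (Z : kmod A) : submodule (top Z).
  split=> [a|a b u x Zx [c cB bc]].
    by split=> [//|c v w Zv Zw lowa]; rewrite Zv // Zw // scaler0 addr0.
  have [->|/le_hom ab] := pselect (u = 0); first exact: act0.
  by rewrite Zx ?linear0 //; exists c => //; exact: le_trans bc.
have [X' [i [i_inj iP]]] := submodule_exists (top_sub X).
have [Y' [j [j_inj jP]]] := submodule_exists (top_sub Y).
have i0 a x : low a -> i a x = 0 by move=> lowa; apply: (iP a _).2; [exists x|].
have j0 a y : low a -> j a y = 0 by move=> lowa; apply: (jP a _).2; [exists y|].
have [|e' e'E] := factor_inj (h := mcomp e i) j_inj.
  by move=> a x; apply/jP => lowa; rewrite /= i0 // linear0.
have e'_surj : msurj e'.
  move=> a y; have [lowa|nlowa] := pselect (low a).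
    by exists 0; apply: j_inj; rewrite !j0.
  have [x xE] := e_surj a (j a y).
  have /iP [x' x'E] : top X a x by [].
  by exists x'; apply: j_inj; rewrite e'E /= x'E.
have [|h' h'E] := factor_inj (h := mcomp h pi) j_inj.
  move=> a x; apply/jP => lowa /=.
  by rewrite ((piP a x).2 (low_span a x lowa)) linear0.
have [g gE] := projective_lift h' Nproj e'_surj.
have [|u uE] := factor_surj (h := mcomp i g) pi_surj.
  move=> a x /piP sx; apply: sx (ker_submodule _) _.
  by apply: all_in_sub ys_low => b z blow; exact: i0.
exists u => a y /=; have [x <-] := pi_surj a y.
have := e'E a (g a x); rewrite gE uE /= => <-.
exact: h'E.
Qed.

Hypothesis A_hered : hereditary A.

Lemma projective_sub K P (i : mhom K P) : projective P -> minj i -> projective K.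
Proof. by move=> Pproj i_inj; apply: A_hered Pproj _; exact: inj_mono i_inj. Qed.

(** The image [J] of [f] is projective.  If it is nonzero at [a], truncation gives
    a finitely generated submodule containing [J a] with projective quotient [D].
    The surjection [M -> D] splits, so [D] is zero or [M = D]; in the second case
    [J a] would vanish. *)
Lemma indecomposable_image_generated M N (f : mhom M N) :
  indecomposable M -> projective N -> locally_fd N -> bounded_below N ->
  image_generated f.
Proof.
move=> [_ Mind] Nproj Nfd Nsup; have [J [e [i [e_surj i_inj ie]]]] := image_factorization f.
suff : image_generated e by apply: image_generated_comp => a x; rewrite -(ie a x).
have [J0|] := pselect (zero_module J).
  by exists [::]; split=> // b x; rewrite (J0 b (e b x)); exact: ((span_submodule _).1 _).1.
move=> /existsNP [a /existsNP [y y0]].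
have [ys [ysP quo_proj]] := projective_truncation [:: (a : {classic A})]
  (projective_sub Nproj i_inj) (lfd_inj i_inj Nfd) (bounded_below_inj i_inj Nsup).
have [D [pi [pi_surj piP]]] := quotient_exists (span_submodule ys).
have piQ : quotient_by pi ys by split=> // b x; rewrite piP.
have pie_surj : msurj (mcomp pi e).
  move=> b z; have [w <-] := pi_surj b z; have [x <-] := e_surj b w.
  by exists x.
have [s sP] := projective_lift (mid D) (quo_proj D pi piQ) pie_surj.
have [K [c [c_inj cP]]] := submodule_exists (ker_submodule (mcomp pi e)).
have [K0|D0] := Mind _ _ (split_isomorphic sP c_inj cP).
  have [x xy] := e_surj a y.
  have /cP [z zE] : mcomp pi e a x = 0.
    by rewrite /= xy; apply/piP; apply: ysP; rewrite inE eqxx.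
  by case: y0; rewrite -xy -zE (K0 a z) !linear0.
exists ys; split; first exact: all_in_true.
by move=> b x; apply/piP; exact: D0.
Qed.

(** Let [K] be the kernel of [q], truncated by [zs] at the objects where [ys]
    lives.  Then [ys] lies in the span of [zs], so the projective module
    [N = K/zs] embeds in [P/(ys ++ zs)]; it contains the image of [L], to which
    the indecomposable summands of [L] contribute finitely generated pieces. *)
Lemma kernel_generated_hereditary L M C (f : mhom L M) (p : mhom M C) s
    (q : mhom (direct_sum (map (@repr_mod k A) s)) C) :
  (forall a : A, locally_fd (repr_mod a)) ->
  short_exact f p -> irreducible_in locally_fd f -> locally_fd C -> msurj q ->
  finite_sum_of_indecomposables L ->
  exists zs, all_in (fun a x => q a x = 0) zs /\
    forall a x, q a x = 0 -> span zs a x.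
Proof.
move=> Pfd fp f_irr Cfd q_surj [n [F [Find [f1 [f2 [f21 _]]]]]].
have {}Pfd := lfd_free s Pfd.
have [ys [qys ysP]] := factor_through_presented fp f_irr Cfd q_surj Pfd.
have [D [pi [h [piP hE]]]] := quotient_by_exists qys.
have [t ht] := ysP D pi h piP hE.
have [K [i [i_inj iP]]] := submodule_exists (ker_submodule q).
have Ksup := bounded_below_inj i_inj (bounded_below_free s).
have Kproj := projective_sub (@projective_free _ _ s) i_inj.
have Kfd := lfd_inj i_inj Pfd.
have [zs [zsP quo_proj]] := projective_truncation
  [seq (projT1 y : {classic A}) | y <- ys] Kproj Kfd Ksup.
have [N [rho [rho_surj rhoP]]] := quotient_exists (span_submodule zs).
have Nproj : projective N by apply: (quo_proj N rho); split=> // a x; rewrite rhoP.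
pose ws := map (mhom_map i) zs.
have qws : all_in (fun a x => q a x = 0) ws.
  by apply/all_in_map/all_in_true => a x; apply/iP; exists x.
have [D' [pi' [h' [r [pi'P h'E rE hr]]]]] := quotient_by_enlarge piP hE qys qws.
have pi'_ws a x : pi' a x = 0 -> span ws a x.
  move=> /pi'P.2 sx; apply: sx (span_submodule ws) _; apply/all_in_cat.
  split; last exact: all_in_span.
  apply: all_in_sub (all_in_tag qys) => b y [bys /iP [z <-]].
  by apply/span_map; exists z => //; exact: zsP.
have [|j jE] := factor_surj (h := mcomp pi' i) rho_surj.
  move=> a x /rhoP sx; apply/pi'P.2 => S Ssub /all_in_cat [_ Sws].
  have sw : span ws a (i a x) by apply/span_map; exists x.
  exact: sw S Ssub Sws.
have j_inj : minj j.
  move=> a; apply: raddf_inj => y; have [x <-] := rho_surj a y.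
  move=> jx0; have := jE a x; rewrite [LHS]jx0 => /esym /pi'_ws.
  by move=> /span_map [x' sx' /i_inj <-]; apply/rhoP.
have [|tau tauE] := factor_inj (h := mcomp (mcomp r t) f) j_inj.
  move=> a x /=; have [z zE] := pi'P.1 a (r a (t a (f a x))).
  have /iP [w wE] : q a z = 0.
    by rewrite -h'E zE hr ht; have [_ _ fpP] := fp; apply/fpP; exists x.
  by exists (rho a w); rewrite jE /= wE.
apply: (kernel_generated_of_image fp (generated_free s) _ pi'P h'E (t := mcomp r t)).
- exact/all_in_cat.
- by move=> a m /=; rewrite hr ht.
apply: (image_generated_comp (f := tau) (j := j)); first by move=> a x; rewrite tauE.
have f2_surj : msurj f2 by move=> a x; exists (f1 a x); exact: (f21 a x).
apply: (image_generated_precomp f2_surj); apply: image_generated_direct_sum => l g.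
apply: indecomposable_image_generated (Find l) Nproj _ _.
  exact: lfd_surj rho_surj Kfd.
exact: bounded_below_surj rho_surj Ksup.
Qed.

End Directed.

(** * Paths in interval finite quivers *)
Section Paths.
Context (Q : quiver).

Fixpoint vertices (x y : Q) (p : qpath x y) : seq {classic Q} :=
  match p with
  | qnil x => [:: (x : {classic Q})]
  | qcons x _ _ _ p' => (x : {classic Q}) :: vertices p'
  end.

Lemma vertices_source (x y : Q) (p : qpath x y) : (x : {classic Q}) \in vertices p.
Proof. by case: p => *; exact: mem_head. Qed.

Lemma vertices_qcat (x y z : Q) (p : qpath x y) (r : qpath y z) :
  (y : {classic Q}) \in vertices (qcat p r).
Proof.
elim: p r => [{}x|{}x {}y w a p IH] r /=; first exact: vertices_source.
by rewrite inE IH orbT.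
Qed.

Lemma interval_vertices (x z : Q) : interval_finite Q ->
  exists F : seq {classic Q}, forall y : Q,
    inhabited (qpath x y) -> inhabited (qpath y z) -> (y : {classic Q}) \in F.
Proof.
move=> Qfin; have /(@finite_seqP {classic qpath x z}) [ps psE] := Qfin x z.
pose V (p : {classic qpath x z}) : seq {classic Q} := vertices (p : qpath x z).
exists (flatten [seq V p | p <- ps]) => y [p] [r].
apply/flatten_mapP; exists (qcat p r : {classic qpath x z}); last exact: vertices_qcat.
by have : [set` ps]%classic (qcat p r) by rewrite -psE.
Qed.

Lemma path_hom_neq0 (k : fieldType) (x y : Q) (g : path_hom k x y) :
  g <> 0 -> inhabited (qpath x y).
Proof.
move=> g0; apply: contrapT => nopath; apply: g0; apply/malgP => p.
by case: nopath; constructor.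
Qed.

End Paths.

(** * Finiteness of the cokernel *)
Theorem proposition3p1 (k : closedFieldType) (A : kcat k)
    (L M C : kmod A) (f : mhom L M) (p : mhom M C) :
  spectroid A ->
  irreducible_in locally_fd f ->
  mono_in locally_fd f ->
  cokernel_in locally_fd f p ->
  [/\ finitely_generated C,
      finitely_generated L -> finitely_presented C,
      irreducible_in locally_fd p -> finitely_presented C
    & forall Q : quiver,
        hereditary A ->
        strongly_locally_finite Q ->
        kcat_isomorphic A (path_category k Q) ->
        finite_sum_of_indecomposables L ->
        finitely_presented C].
Proof.
move=> [Hfd _ _] f_irr f_mono p_coker.
have Pfd (a : A) : locally_fd (repr_mod a) by exact: Hfd.
have [Lfd Mfd f_nsect _ _] := f_irr.
have fp := cokernel_exact (mono_inj Pfd f_mono) Mfd p_coker.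
have Cfd : locally_fd C by case: p_coker.
have Cgen := cokernel_generated fp f_irr Cfd.
have [s [q /epi_surj q_surj]] := (generatedP C).2 Cgen.
have [ys [qys ysP]] := factor_through_presented fp f_irr Cfd q_surj (lfd_free s Pfd).
have [D [pi [h [piP hE]]]] := quotient_by_exists qys.
have [t ht] := ysP D pi h piP hE.
have fg_ker zs : all_in (fun a x => q a x = 0) zs /\ (forall a x, q a x = 0 -> span zs a x) ->
    finitely_presented C.
  by move=> [qzs zsP]; exact: finitely_presentedI q_surj qzs zsP.
split; first exact/generatedP.
- move=> /generatedP Lgen.
  have [zs] := kernel_generated_of_image fp (generated_free s) qys piP hE ht
    (image_generated_source _ Lgen).
  exact: fg_ker.
- move=> [_ _ _ _ p_fact].
  have [a [x x0]] : exists a (x : L a), x <> 0.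
    apply: contrapT => L0; apply: f_nsect; exists (mzero M L) => a x /=.
    by apply: contrapT => x0; apply: L0; exists a, x => /esym.
  have fpP a' y : p a' y = 0 <-> exists x, f a' x = y by have [] := fp.
  have [z zE] := piP.1 a (t a (f a x)).
  have qz : q a z = 0 by rewrite -hE zE ht; apply/fpP; exists x.
  have [|D' [pi' [h' [r [pi'P h'E rE hr]]]]] :=
    quotient_by_enlarge piP hE qys (zs := [:: existT _ a z]); first by [].
  (* [z] lifts the image of the nonzero element [x] of [L], so the composite
     [M -> P/(ys ++ [z])] is not injective and cannot be a section. *)
  have rtf0 : r a (t a (f a x)) = 0.
    by rewrite -zE rE; apply/pi'P.2 => S _ /all_in_cat [_ []].
  have [||[u uP]|[u uP]] := p_fact D' _ (mcomp r t) h'.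
  + exact: lfd_surj pi'P.1 (lfd_free s Pfd).
  + by move=> b m /=; rewrite hr ht.
  + case: x0; apply: (mono_inj Pfd f_mono); rewrite linear0.
    by rewrite -[LHS](uP a) /= rtf0 linear0.
  have [|zs] := kernel_generated_of_section (u := u) (generated_free s) _ pi'P h'E uP.
    by apply/all_in_cat.
  exact: fg_ker.
move=> Q A_hered [_ Qfin] [F [FH [[F' FK F'K] FHbij _ _]]] Lind.
pose le (a b : A) := inhabited (qpath (F a : Q) (F b)).
have [||||zs] := @kernel_generated_hereditary _ A le _ _ _ _ A_hered L M C f p s q
  Pfd fp f_irr Cfd q_surj Lind; last exact: fg_ker.
- by move=> a b c [v] [w]; constructor; exact: qcat v w.
- by move=> a; constructor; exact: qnil.
- move=> a b u u0; apply: (@path_hom_neq0 Q k _ _ (FH a b u)) => FHu0; apply: u0.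
  by apply: (bij_inj (FHbij a b)); rewrite FHu0 linear0.
move=> a b; have [V VP] := interval_vertices (F a) (F b) Qfin.
exists (map (F' : {classic Q} -> {classic A}) V) => c ac cb; rewrite -(FK c); apply: map_f.
exact: VP.
Qed.
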